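(* Let $A$ be an admissible subset of $\mathcal{C}^{2,3}$. Then a compatible order on $A_{\mathcal{T}}=A\cap\mathcal{T}$ always exists, and for every compatible order $\prec$, writing $A_{\mathcal{T}}=\{\sigma_1,\dots,\sigma_k\}$ with $\sigma_1\prec\cdots\prec\sigma_k$, one has $\pi(A)=\sigma_1\sigma_2\cdots\sigma_k$. (In particular, the product depends only on $A$.) Consequently, every smooth permutation $\sigma\in S_n$ may be written as the product, in an appropriate order, of the transpositions in $\mathbf{C}_{\mathcal{T}}(\sigma)$ (each appearing exactly once).
   Context: $S_n$ is the group of permutations of $[n]=\{1,\dots,n\}$, $n\ge1$, products being composition of functions, $(\sigma\tau)(i)=\sigma(\tau(i))$, with the Bruhat order $\le$: $\tau\le\sigma$ iff $\#(\tau([i])\cap[j])\ge\#(\sigma([i])\cap[j])$ for all $i,j\in[n]$. $\mathcal{T}=\{T_{i,j}:1\le i<j\le n\}$ is the set of transpositions; for $i<j<k$, $R_{i,j,k}$ is the $3$-cycle $i\mapsto j\mapsto k\mapsto i$; $\mathcal{C}^{2,3}=\mathcal{T}\cup\{R_{i,j,k},R_{i,j,k}^{-1}:i<j<k\}$. For $\sigma\in S_n$, $\mathbf{C}_{\mathcal{T}}(\sigma)=\{\tau\in\mathcal{T}:\tau\le\sigma\}$ and $\mathbf{C}(\sigma)=\{\tau\in\mathcal{C}^{2,3}:\tau\le\sigma\}$. With $\ell(\sigma)=\#\{i<j:\sigma(i)>\sigma(j)\}$, $\sigma$ is smooth if $\ell(\sigma)=\#\mathbf{C}_{\mathcal{T}}(\sigma)$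 (equivalently, as is known, $\sigma$ avoids $4231$ and $3412$). A subset $A\subseteq\mathcal{C}^{2,3}$ is admissible if (a) it is downward closed: $\sigma\in A$, $\tau\in\mathcal{C}^{2,3}$, $\tau\le\sigma$ imply $\tau\in A$; (b) if $R_{i,j,l},R_{i,k,l}^{-1}\in A$ with $i<j<l$, $i<k<l$, then $T_{i,l}\in A$; (c) whenever $T_{i,j},T_{j,k}\in A$ with $i<j<k$, at least one of $R_{i,j,k},R_{i,j,k}^{-1}$ belongs to $A$. For admissible $A$, $\pi(A)$ denotes the greatest element, with respect to the Bruhat order, of $\{\tau\in S_n:\mathbf{C}(\tau)=A\}$ (this greatest element exists, and it is smooth). A (strict) linear order $\prec$ on $A_{\mathcal{T}}$ is compatible (with $A$) if whenever $T_{i,j},T_{j,k}\in A$ with $i<j<k$: if $T_{i,k}\in A$, then either $T_{i,j}\prec T_{i,k}\prec T_{j,k}$ or $T_{j,k}\prec T_{i,k}\prec T_{i,j}$; and if $T_{i,k}\notin A$, then $R_{i,j,k}\in A\iff T_{i,j}\prec T_{j,k}$. *)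

(* Defs.v *)
From mathcomp Require Import all_boot all_fingroup.

Set Implicit Arguments.
Unset Strict Implicit.
Unset Printing Implicit Defensive.

Local Open Scope group_scope.

Section Definitions.

Variable n : nat.
Implicit Types (s t p : 'S_n) (i j k l : 'I_n) (A : {set 'S_n}).

(* The index set [n] = {1, ..., n} is 'I_n, shifted by one.                  *)

(* The group law of 'S_n is (s * t) x = t (s x); permcomp is the opposite    *)
(* law, i.e., composition of functions.                                      *)
Definition permcomp s t : 'S_n := t * s.

Lemma permcompE s t i : permcomp s t i = s (t i).
Proof. exact: permM. Qed.

Definition permcomp_prod (w : seq 'S_n) : 'S_n := \big[permcomp/1]_(s <- w) s.

(* The i + 1 smallest elements, i.e., [i + 1].                               *)
Definition initseg i : {set 'I_n} := [set x : 'I_n | (x <= i)%N].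

Definition bruhat t s : bool :=
  [forall i : 'I_n, forall j : 'I_n,
    (#|[set s x | x in initseg i] :&: initseg j|
       <= #|[set t x | x in initseg i] :&: initseg j|)%N].

Definition transpositions : {set 'S_n} :=
  [set s : 'S_n |
    [exists i : 'I_n, exists j : 'I_n, (i < j)%N && (s == tperm i j)]].

Definition cycle3 i j k : 'S_n := permcomp (tperm i j) (tperm j k).

Lemma cycle3E i j k : (i < j)%N -> (j < k)%N ->
  [/\ cycle3 i j k i = j, cycle3 i j k j = k, cycle3 i j k k = i
    & forall x, x != i -> x != j -> x != k -> cycle3 i j k x = x].
Proof.
move=> ltij ltjk; have ltik := ltn_trans ltij ltjk.
have neq (a b : 'I_n) : (a < b)%N -> (a != b) && (b != a).
  by move=> ltab; rewrite -!val_eqE /= ltn_eqF ?gtn_eqF.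
have /andP[ij ji] := neq _ _ ltij; have /andP[jk kj] := neq _ _ ltjk.
have /andP[ik ki] := neq _ _ ltik.
split=> [|||x xi xj xk]; rewrite permcompE.
- by rewrite (tpermD ji ki) tpermL.
- by rewrite tpermL (tpermD ik jk).
- by rewrite tpermR tpermR.
- by rewrite !tpermD // eq_sym.
Qed.

Definition cycles23 : {set 'S_n} :=
  transpositions :|:
  [set s : 'S_n | [exists i : 'I_n, exists j : 'I_n, exists k : 'I_n,
    [&& (i < j)%N, (j < k)%N
      & (s == cycle3 i j k) || (s == (cycle3 i j k)^-1)]]].

Definition below_T s : {set 'S_n} := [set t in transpositions | bruhat t s].

Definition below s : {set 'S_n} := [set t in cycles23 | bruhat t s].

Definition perm_length s : nat :=
  #|[set u : 'I_n * 'I_n | (u.1 < u.2)%N && (s u.2 < s u.1)%N]|.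

Definition smooth s : bool := perm_length s == #|below_T s|.

Definition admissible A : Prop :=
  [/\ A \subset cycles23,
      forall s t, s \in A -> t \in cycles23 -> bruhat t s -> t \in A,
      forall i j k l, (i < j)%N -> (j < l)%N -> (i < k)%N -> (k < l)%N ->
        cycle3 i j l \in A -> (cycle3 i k l)^-1 \in A -> tperm i l \in A
    & forall i j k, (i < j)%N -> (j < k)%N ->
        tperm i j \in A -> tperm j k \in A ->
        cycle3 i j k \in A \/ (cycle3 i j k)^-1 \in A].

Definition is_adm_pi A p : bool :=
  (below p == A) && [forall t, (below t == A) ==> bruhat t p].

(* The value 1 is used only when there is no greatest element.               *)
Definition adm_pi A : 'S_n := odflt 1 [pick p | is_adm_pi A p].

Definition part_T A : {set 'S_n} := A :&: transpositions.

Definition strict_linear_on (D : {set 'S_n}) (prec : rel 'S_n) : Prop :=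
  [/\ {in D, forall s, ~~ prec s s},
      {in D & &, transitive prec}
    & {in D &, forall s t, s != t -> prec s t || prec t s}].

Definition compatible A (prec : rel 'S_n) : Prop :=
  strict_linear_on (part_T A) prec /\
  forall i j k, (i < j)%N -> (j < k)%N -> tperm i j \in A -> tperm j k \in A ->
    (tperm i k \in A ->
       (prec (tperm i j) (tperm i k) /\ prec (tperm i k) (tperm j k)) \/
       (prec (tperm j k) (tperm i k) /\ prec (tperm i k) (tperm i j))) /\
    (tperm i k \notin A ->
       (cycle3 i j k \in A <-> prec (tperm i j) (tperm j k))).

End Definitions.

(* Main.v *)
(* For i < j < k, T_{i,j} <= s iff some x <= i has s x >= j and some y <= i has
   s^-1 y >= j; similar conditions describe R_{i,j,k} <= s, so C(s) only depends
   on the two relations "some x <= i has s x >= j" of s and of s^-1 (reach).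

   Let k be the least index moved by an element of the admissible set A and let
   m be the largest index with T_{k,m} in A (m = k if there is none).  By (b)
   and (c), after possibly replacing A by {s^-1 : s in A}, R_{k,i,j} is in A
   whenever T_{k,i} and T_{i,j} are.  Let A' be the set of the elements of A
   that fix k.  Then pi(A) = c pi(A'), where c = T_{k,k+1} ... T_{k,m} is the
   cycle m -> m - 1 -> ... -> k -> m.  A compatible order for A' becomes one for
   A by putting T_{k,k+1}, ..., T_{k,m} in front.  In an arbitrary compatible
   order for A, the r-th of the T_{k,j}'s becomes T_{k,k+r} when it is moved to
   the front across the elements of A' that precede it: the image of j under
   their product can be computed by counting, since T_{a,b} and T_{b,c} lie on
   opposite sides of T_{a,c} whenever all three belong to A.

   A permutation s fixing all i < k with m = s k <= s^-1 k is likewise c t with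
   t fixing k, length s <= length t + (m - k) and
   #C_T(s) >= #C_T(t) + (m - k).  So length s <= #C_T(s) by induction, and for
   smooth s equality holds throughout and C_T(s) consists of C_T(t) and the
   T_{k,j} with k < j <= m. *)
Require Import Defs.
From mathcomp Require Import all_boot all_fingroup.
From mathcomp Require Import zify.

Set Implicit Arguments.
Unset Strict Implicit.
Unset Printing Implicit Defensive.

Local Open Scope group_scope.

(** * Bruhat order on transpositions and 3-cycles *)

Section Reach.

Variable n : nat.
Implicit Types (s t p : 'S_n) (x y z u : 'I_n) (i j a b : nat).

(** With u(i) the maximum of [s] on {0,...,i}, this says j <= u(i); for [s^-1] it bounds the
    analogous l(i). The arguments are natural numbers so that a threshold [m.+1] may equal n. *)
Definition reach s i j := [exists x : 'I_n, (x <= i) && (j <= s x)].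

Lemma reachP s i j : reflect (exists2 x : 'I_n, x <= i & j <= s x) (reach s i j).
Proof.
by apply: (iffP existsP) => [[x /andP[]]|[x xi jx]]; exists x => //; apply/andP.
Qed.

Lemma reachI s i j x : x <= i -> j <= s x -> reach s i j.
Proof. by move=> xi jx; apply/reachP; exists x. Qed.

Lemma reach_le s i j i' j' : reach s i j -> i <= i' -> j' <= j -> reach s i' j'.
Proof.
by move=> /reachP[x xi jx] ii jj; apply: (@reachI _ _ _ x); lia.
Qed.

Lemma card_ord_le a : a < n -> #|[set x : 'I_n | x <= a]| = a.+1.
Proof.
move=> an; have inj : injective (widen_ord an) by move=> y z [] /val_inj.
rewrite -[RHS]card_ord -(card_imset _ inj).
apply: eq_card => x; rewrite inE; apply/idP/imsetP => [xa|[y _ ->]] /=.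
  by exists (Ordinal (xa : x < a.+1)) => //; apply: val_inj.
by rewrite -ltnS.
Qed.

Lemma reach_diag s i j : i < n -> j <= i -> reach s i j.
Proof.
move=> i_n ji; apply: contraT => /existsPn /= H.
case: i => [|i] in i_n ji H *.
  by have := H (Ordinal i_n); move: ji; rewrite leqn0 => /eqP->; rewrite !leq0n.
have: s @: [set x : 'I_n | x <= i.+1] \subset [set x : 'I_n | x <= i].
  apply/subsetP => _ /imsetP[x + ->]; rewrite !inE => xi.
  by have := H x; rewrite xi /= -ltnNge => /leq_trans/(_ ji).
move/subset_leq_card; rewrite card_imset; last exact: perm_inj.
by rewrite !card_ord_le ?ltnn // ltnW.
Qed.

(* Both sides say that s does not preserve {0, ..., i}. *)
Lemma reachV_succ s i : reach s i i.+1 -> reach s^-1 i i.+1.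
Proof.
move=> /reachP[x xi ix]; apply: contraT => /existsPn /= H.
have sub: s^-1 @: [set z : 'I_n | z <= i] \subset [set z : 'I_n | z <= i].
  apply/subsetP => _ /imsetP[z + ->]; rewrite !inE => zi.
  by have := H z; rewrite zi /= -leqNgt.
have /eqP eqI: s^-1 @: [set z : 'I_n | z <= i] == [set z : 'I_n | z <= i].
  by rewrite eqEcard sub (card_imset _ (@perm_inj _ _)) leqnn.
have: x \in s^-1 @: [set z : 'I_n | z <= i] by rewrite eqI inE.
by case/imsetP => z; rewrite inE => zi xE; move: ix; rewrite xE permKV ltnNge zi.
Qed.

Lemma reach_succV s i : reach s^-1 i i.+1 = reach s i i.+1.
Proof. by apply/idP/idP => /reachV_succ; rewrite ?invgK. Qed.

Lemma reach_max s (i : 'I_n) :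
  exists m : 'I_n, [/\ i <= m, reach s i m & ~~ reach s i m.+1].
Proof.
have Hi : reach s i i by apply: reach_diag.
have := @arg_maxnP 'I_n i (fun m => reach s i m) val Hi.
case=> m rm mx; exists m; split => //; first exact: mx.
apply/negP => r; have /reachP[x xi mx'] := r.
by have := mx (Ordinal (leq_ltn_trans mx' (ltn_ord _))) r => /=; lia.
Qed.

(** * Rank functions and the Bruhat order *)

Definition rank s a b := #|[set x : 'I_n | (x <= a) && (s x <= b)]|.
Definition excess s a b := #|[set x : 'I_n | (x <= a) && (b < s x)]|.

Lemma rank_excess s a b : rank s a b + excess s a b = #|[set x : 'I_n | x <= a]|.
Proof.
rewrite -(cardsID [set x | s x <= b]); congr (_ + _); apply: eq_card => x.
  by rewrite !inE.
by rewrite !inE -ltnNge andbC.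
Qed.

Lemma rankV s a b : rank s^-1 a b = rank s b a.
Proof.
rewrite /rank -[RHS](card_imset _ (@perm_inj _ s)); apply: eq_card => x.
rewrite !inE; apply/idP/imsetP => [/andP[xa xb]|[y + ->]].
  by exists (s^-1 x); rewrite ?permKV // inE permKV xa xb.
by rewrite inE permK andbC.
Qed.

Lemma bruhatP t s :
  reflect (forall x y : 'I_n, rank s x y <= rank t x y) (bruhat t s).
Proof.
have E p x y : #|[set p z | z in initseg x] :&: initseg y| = rank p x y.
  rewrite /rank -[RHS](card_imset _ (@perm_inj _ p)); apply: eq_card => z; rewrite !inE.
  apply/andP/imsetP => [[/imsetP[u ux ->] uy]|[u + ->]].
    by exists u => //; move: ux; rewrite !inE => ->.
  by rewrite inE => /andP[ux uy]; split => //; rewrite imset_f ?inE.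
apply: (iffP forallP) => [H x y|H x].
  by have := forallP (H x) y; rewrite !E.
by apply/forallP => y; rewrite !E.
Qed.

Lemma bruhatV t s : bruhat t^-1 s^-1 = bruhat t s.
Proof.
apply/bruhatP/bruhatP => H x y; first by rewrite -[rank s _ _]rankV -[rank t _ _]rankV.
by rewrite !rankV.
Qed.

(** On and above the diagonal rank and excess are complementary; below it, [rankV] moves the
    comparison to the inverses. *)
Lemma bruhat_excess t s :
  (forall x y : 'I_n, x <= y -> excess t x y <= excess s x y) ->
  (forall x y : 'I_n, x <= y -> excess t^-1 x y <= excess s^-1 x y) ->
  bruhat t s.
Proof.
move=> H H'; apply/bruhatP => x y.
have [xy|/ltnW yx] := leqP x y.
  by have := H x y xy; have := rank_excess t x y; have := rank_excess s x y; lia.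
rewrite -[rank s _ _]rankV -[rank t _ _]rankV; have := H' y x yx.
by have := rank_excess t^-1 y x; have := rank_excess s^-1 y x; lia.
Qed.

Lemma excess_gt0 s i j : (0 < excess s i j) = reach s i j.+1.
Proof.
apply/card_gt0P/reachP => [[x]|[x xi jx]]; last by exists x; rewrite inE xi.
by rewrite inE => /andP[]; exists x.
Qed.

Lemma bruhat_reach t s i j : bruhat t s -> reach t i j -> reach s i j.
Proof.
(* For i >= n every position is allowed, and [s] takes the value [t x] at [s^-1 (t x)]. *)
move=> /bruhatP H r; have [i_n|n_i] := ltnP i n; last first.
  have /reachP[x _ jx] := r; apply: (@reachI _ _ _ (s^-1 (t x))); last by rewrite permKV.
  by apply: ltnW; apply: leq_trans n_i.
have [ji|ij] := leqP j i; first exact: reach_diag.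
case: j => // j in ij r *; have [x _ jx] := reachP _ _ _ r.
have j_n : j < n by apply: ltn_trans jx _.
have := H (Ordinal i_n) (Ordinal j_n); move: r; rewrite -!excess_gt0 /=.
by have := rank_excess t i j; have := rank_excess s i j; lia.
Qed.

(** If the excess of [t] and [t^-1] is at most 1 on and above the diagonal, comparing it with that
    of [s] only asks where it is positive, which is what [reach] records. Transpositions and
    3-cycles are of this kind. *)
Lemma bruhat_small t s :
  (forall x y : 'I_n, x <= y -> excess t x y <= 1) ->
  (forall x y : 'I_n, x <= y -> excess t^-1 x y <= 1) ->
  (forall i j, i < n -> reach t i j -> reach s i j) ->
  (forall i j, i < n -> reach t^-1 i j -> reach s^-1 i j) -> bruhat t s.
Proof.
move=> S S' H H'; apply: bruhat_excess => x y xy.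
  have := H x y.+1 (ltn_ord x); have := S x y xy; rewrite -!excess_gt0; lia.
have := H' x y.+1 (ltn_ord x); have := S' x y xy; rewrite -!excess_gt0; lia.
Qed.

Lemma excess_tperm x y (a b : 'I_n) : x < y -> a <= b -> excess (tperm x y) a b <= 1.
Proof.
move=> xy ab; rewrite -(cards1 x); apply: subset_leq_card; apply/subsetP => z.
rewrite !inE; case: tpermP => [->|->|_ _] //; rewrite -?val_eqE /=; lia.
Qed.

(** Only x is raised by T_{x,y}; all other positions impose diagonal conditions, which always hold.
    So one threshold for [s] and one for [s^-1] suffice. *)
Lemma bruhat_tperm s x y : x < y -> bruhat (tperm x y) s = reach s x y && reach s^-1 x y.
Proof.
move=> xy; apply/idP/andP => [B|[r r']].
  split; first by apply: bruhat_reach B _; apply: (@reachI _ _ _ x); rewrite ?tpermL.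
  have B' : bruhat (tperm x y) s^-1 by rewrite -[tperm x y]tpermV bruhatV.
  by apply: bruhat_reach B' _; apply: (@reachI _ _ _ x); rewrite ?tpermL.
have E p i j : reach p x y -> i < n -> reach (tperm x y) i j -> reach p i j.
  move=> rp i_n /reachP[z]; case: tpermP => [->|->|_ _] zi jz.
  - exact: reach_le rp _ _.
  - by apply: reach_diag => //; lia.
  - by apply: reach_diag => //; lia.
apply: bruhat_small => *; rewrite ?tpermV ?excess_tperm //; first exact: E.
by apply: E => //; rewrite -[tperm x y]tpermV.
Qed.

Lemma cycle3VE x y z : x < y -> y < z ->
  [/\ (cycle3 x y z)^-1 x = z, (cycle3 x y z)^-1 y = x, (cycle3 x y z)^-1 z = y
    & forall u, u != x -> u != y -> u != z -> (cycle3 x y z)^-1 u = u].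
Proof.
move=> xy yz; have [cx cy cz cu] := cycle3E xy yz.
by split=> *; apply: (canLR (permK _)); rewrite ?cx ?cy ?cz ?cu.
Qed.

Variant cycle3_spec x y z u : 'I_n -> Type :=
| Cycle3_1 of u = x : cycle3_spec x y z u y
| Cycle3_2 of u = y : cycle3_spec x y z u z
| Cycle3_3 of u = z : cycle3_spec x y z u x
| Cycle3_other of u != x & u != y & u != z : cycle3_spec x y z u u.

Lemma cycle3P x y z u : x < y -> y < z -> cycle3_spec x y z u (cycle3 x y z u).
Proof.
move=> xy yz; have [cx cy cz cu] := cycle3E xy yz.
have [->|ux] := eqVneq u x; first by rewrite cx; constructor.
have [->|uy] := eqVneq u y; first by rewrite cy; constructor.
have [->|uz] := eqVneq u z; first by rewrite cz; constructor.
by rewrite cu //; constructor.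
Qed.

Lemma cycle3VP x y z u : x < y -> y < z -> cycle3_spec x z y u ((cycle3 x y z)^-1 u).
Proof.
move=> xy yz; have [cx cy cz cu] := cycle3VE xy yz.
have [->|ux] := eqVneq u x; first by rewrite cx; constructor.
have [->|uy] := eqVneq u y; first by rewrite cy; constructor.
have [->|uz] := eqVneq u z; first by rewrite cz; constructor.
by rewrite cu //; constructor.
Qed.

Lemma bruhat_cycle3 s x y z : x < y -> y < z ->
  bruhat (cycle3 x y z) s = [&& reach s x y, reach s y z & reach s^-1 x z].
Proof.
move=> xy yz; have [cx cy cz _] := cycle3E xy yz; have [vx _ _ _] := cycle3VE xy yz.
apply/idP/and3P => [B|[r1 r2 r3]].
  split.
  - by apply: bruhat_reach B _; apply: (@reachI _ _ _ x); rewrite ?cx.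
  - by apply: bruhat_reach B _; apply: (@reachI _ _ _ y); rewrite ?cy.
  - rewrite -bruhatV in B.
    by apply: bruhat_reach B _; apply: (@reachI _ _ _ x); rewrite ?vx.
apply: bruhat_small => [a b ab|a b ab|a b a_n|a b a_n].
(* Only x and y are raised. If y <= a <= b, then x, whose image is y, is not counted; if a < y, then
   y is out of range. *)
- case: (leqP y a) => ya.
    rewrite -(cards1 y); apply: subset_leq_card; apply/subsetP => u.
    rewrite !inE; case: cycle3P => //; rewrite -?val_eqE /=; try move=> ->; lia.
  rewrite -(cards1 x); apply: subset_leq_card; apply/subsetP => u.
  rewrite !inE; case: cycle3P => //; rewrite -?val_eqE /=; try move=> ->; lia.
- rewrite -(cards1 x); apply: subset_leq_card; apply/subsetP => u.
  rewrite !inE; case: cycle3VP => //; rewrite -?val_eqE /=; try move=> ->; lia.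
- case/reachP => u; case: cycle3P => // [->|->|->|_ _ _] ua ub.
  + exact: reach_le r1 _ _.
  + exact: reach_le r2 _ _.
  + by apply: reach_diag => //; lia.
  + by apply: reach_diag => //; lia.
- case/reachP => u; case: cycle3VP => // [->|->|->|_ _ _] ua ub.
  + exact: reach_le r3 _ _.
  + by apply: reach_diag => //; lia.
  + by apply: reach_diag => //; lia.
  + by apply: reach_diag => //; lia.
Qed.

Lemma bruhat_cycle3V s x y z : x < y -> y < z ->
  bruhat (cycle3 x y z)^-1 s = [&& reach s^-1 x y, reach s^-1 y z & reach s x z].
Proof. by move=> xy yz; rewrite -bruhatV invgK bruhat_cycle3 // invgK. Qed.

End Reach.

(** * Admissible sets *)

Section Admissible.

Variable n : nat.
Implicit Types (s t p : 'S_n) (x y z i j k l m : 'I_n) (A : {set 'S_n}).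

Lemma mem_transpositions i j : i < j -> tperm i j \in transpositions n.
Proof. by move=> ij; rewrite inE; apply/existsP; exists i; apply/existsP; exists j; rewrite ij eqxx. Qed.

Lemma mem_cycles23 i j k : i < j -> j < k ->
  [/\ tperm i j \in cycles23 n, cycle3 i j k \in cycles23 n
    & (cycle3 i j k)^-1 \in cycles23 n].
Proof.
move=> ij jk; split; rewrite inE ?mem_transpositions //; apply/orP; right; rewrite inE;
  by apply/existsP; exists i; apply/existsP; exists j; apply/existsP; exists k;
     rewrite ij jk eqxx ?orbT.
Qed.

Lemma tperm_cycles23 i j : i < j -> tperm i j \in cycles23 n.
Proof. by move=> ij; rewrite inE mem_transpositions. Qed.

Variant cycles23_spec : 'S_n -> Prop :=
| Cycles23_T i j of i < j : cycles23_spec (tperm i j)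
| Cycles23_R i j k of i < j & j < k : cycles23_spec (cycle3 i j k)
| Cycles23_V i j k of i < j & j < k : cycles23_spec (cycle3 i j k)^-1.

Lemma cycles23P s : s \in cycles23 n -> cycles23_spec s.
Proof.
rewrite !inE => /orP[/existsP[i /existsP[j /andP[ij /eqP->]]]|]; first by constructor.
move=> /existsP[i /existsP[j /existsP[k /and3P[ij jk /orP[]/eqP->]]]]; by constructor.
Qed.

Lemma transpositionsP s :
  s \in transpositions n -> exists i j, i < j /\ s = tperm i j.
Proof. by rewrite !inE => /existsP[i /existsP[j /andP[ij /eqP->]]]; exists i, j. Qed.

Lemma mem_cycles23V s : (s^-1 \in cycles23 n) = (s \in cycles23 n).
Proof.
have H p : p \in cycles23 n -> p^-1 \in cycles23 n.
  case/cycles23P => [i j ij|i j k ij jk|i j k ij jk]; rewrite ?invgK ?tpermV ?tperm_cycles23 //.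
  by case: (mem_cycles23 ij jk).
  by case: (mem_cycles23 ij jk).
by apply/idP/idP => /H //; rewrite invgK.
Qed.

Lemma mem_below s t : (t \in below s) = (t \in cycles23 n) && bruhat t s.
Proof. by rewrite [LHS]in_set. Qed.

Lemma mem_belowT s i j : i < j -> (tperm i j \in below s) = reach s i j && reach s^-1 i j.
Proof. by move=> ij; rewrite mem_below tperm_cycles23 //= bruhat_tperm. Qed.

Lemma mem_belowR s i j k : i < j -> j < k ->
  (cycle3 i j k \in below s) = [&& reach s i j, reach s j k & reach s^-1 i k].
Proof. by move=> ij jk; case: (mem_cycles23 ij jk) => _ H _; rewrite mem_below H /= bruhat_cycle3. Qed.

Lemma mem_belowV s i j k : i < j -> j < k ->
  ((cycle3 i j k)^-1 \in below s) = [&& reach s^-1 i j, reach s^-1 j k & reach s i k].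
Proof. by move=> ij jk; case: (mem_cycles23 ij jk) => _ _ H; rewrite mem_below H /= bruhat_cycle3V. Qed.

Lemma part_TP A i j : i < j -> (tperm i j \in part_T A) = (tperm i j \in A).
Proof. by move=> ij; rewrite inE mem_transpositions ?andbT. Qed.

Lemma belowV s : below s^-1 = (below s)^-1.
Proof. by apply/setP => t; rewrite mem_invg !mem_below mem_cycles23V -bruhatV invgK. Qed.

Lemma eq_below A s : A \subset cycles23 n ->
  (forall i j, i < j -> (tperm i j \in below s) = (tperm i j \in A)) ->
  (forall i j k, i < j -> j < k -> (cycle3 i j k \in below s) = (cycle3 i j k \in A)) ->
  (forall i j k, i < j -> j < k -> ((cycle3 i j k)^-1 \in below s) = ((cycle3 i j k)^-1 \in A)) ->
  below s = A.
Proof.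
move=> /subsetP sA HT HR HV; apply/setP => t; have [tC|tC] := boolP (t \in cycles23 n).
  by case/cycles23P: tC => *; [apply: HT|apply: HR|apply: HV].
rewrite [RHS](contraNF (sA t) tC); by rewrite mem_below (negPf tC).
Qed.

Lemma admissibleV A : admissible A -> admissible A^-1.
Proof.
case=> sA dA bA cA; split.
- by apply/subsetP => s; rewrite mem_invg => /(subsetP sA); rewrite mem_cycles23V.
- move=> s t; rewrite !mem_invg => sA' tC ts; apply: dA sA' _ _; first by rewrite mem_cycles23V.
  by rewrite bruhatV.
- move=> i j k l ij jl ik kl; rewrite !mem_invg tpermV invgK => H1 H2.
  exact: (bA i k j l).
- move=> i j k ij jk; rewrite !mem_invg !tpermV invgK => H1 H2.
  by case: (cA i j k ij jk H1 H2); [right|left].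
Qed.

Section AdmFacts.

Variable A : {set 'S_n}.
Hypothesis admA : admissible A.

Lemma adm_nested i j i' j' : tperm i j \in A -> i <= i' -> i' < j' -> j' <= j ->
  tperm i' j' \in A.
Proof.
case: admA => _ dA _ _ H ii ij jj; apply: dA H (tperm_cycles23 ij) _.
by rewrite bruhat_tperm // tpermV !(@reachI _ _ _ _ i) // tpermL.
Qed.

Lemma adm_TR i j k : i < j -> j < k -> tperm i k \in A ->
  cycle3 i j k \in A /\ (cycle3 i j k)^-1 \in A.
Proof.
move=> ij jk H; case: admA => _ dA _ _; case: (mem_cycles23 ij jk) => _ cR cV.
split; apply: dA H _ _ => //; rewrite ?bruhat_cycle3 ?bruhat_cycle3V // tpermV;
  by rewrite !(@reachI _ _ _ _ i) ?tpermL // ltnW.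
Qed.

Lemma adm_RT i j k : i < j -> j < k -> cycle3 i j k \in A ->
  tperm i j \in A /\ tperm j k \in A.
Proof.
move=> ij jk H; case: admA => _ dA _ _; have [ci cj ck _] := cycle3E ij jk.
have [vi vj vk _] := cycle3VE ij jk.
split; apply: dA H (tperm_cycles23 _) _ => //; rewrite bruhat_tperm //.
  by rewrite !(@reachI _ _ _ _ i) // ?ci ?vi // ltnW.
by rewrite (@reachI _ _ _ _ j) ?cj // (@reachI _ _ _ _ i) // ?vi // ltnW.
Qed.

Lemma adm_VT i j k : i < j -> j < k -> (cycle3 i j k)^-1 \in A ->
  tperm i j \in A /\ tperm j k \in A.
Proof.
move=> ij jk H; case: admA => _ dA _ _; have [ci cj ck _] := cycle3E ij jk.
have [vi vj vk _] := cycle3VE ij jk.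
split; apply: dA H (tperm_cycles23 _) _ => //; rewrite bruhat_tperm // ?invgK.
  by rewrite !(@reachI _ _ _ _ i) // ?ci ?vi // ltnW.
by rewrite andbC (@reachI _ _ _ _ j) ?cj // (@reachI _ _ _ _ i) // ?vi // ltnW.
Qed.

Lemma adm_R_nested i j k i' k' : j < k -> cycle3 i j k \in A ->
  i <= i' -> i' < j -> j < k' -> k' <= k -> cycle3 i' j k' \in A.
Proof.
move=> jk H ii ij jk' kk; case: admA => _ dA _ _.
have ij' : i < j by exact: leq_ltn_trans ij.
have [ci cj ck _] := cycle3E ij' jk; have [vi vj vk _] := cycle3VE ij' jk.
apply: dA H _ _; first by case: (mem_cycles23 ij jk').
by rewrite bruhat_cycle3 // (@reachI _ _ _ _ i) ?ci // (@reachI _ _ _ _ j) ?cj //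
           (@reachI _ _ _ _ i) ?vi.
Qed.

End AdmFacts.

Lemma adm_V_nested A i j k i' k' : admissible A -> j < k -> (cycle3 i j k)^-1 \in A ->
  i <= i' -> i' < j -> j < k' -> k' <= k -> (cycle3 i' j k')^-1 \in A.
Proof.
move=> /admissibleV admA jk; rewrite -!mem_invg; exact: adm_R_nested.
Qed.

Definition R_oriented A i := forall j k, i < j -> j < k ->
  tperm i j \in A -> tperm j k \in A -> cycle3 i j k \in A.

(** If R_{i,j,k} is missing for one pair, then (c) supplies its inverse, and T_{i,k} is missing as
    well. Given R_{i,j',k'} in A, shrink whichever of these two 3-cycles has the larger last index;
    (b) then yields T_{i,k} or T_{i,k'}. The former is excluded, and the latter puts the inverse of
    R_{i,j',k'} in A. *)
Lemma adm_oriented A i : admissible A -> R_oriented A i \/ R_oriented A^-1 i.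
Proof.
move=> admA; case: (admA) => _ _ bA cA.
have [/'exists_existsP[j [k /and5P[ij jk Tij Tjk nR]]]|H] := boolP [exists j : 'I_n, exists k : 'I_n,
  [&& i < j, j < k, tperm i j \in A, tperm j k \in A & cycle3 i j k \notin A]]; last first.
  left=> j k ij jk Tij Tjk; apply: contraR H => nR.
  by apply/existsP; exists j; apply/existsP; exists k; apply/and5P.
right=> j' k' ij' jk'; rewrite !mem_invg !tpermV => Tij' Tjk'.
have V : (cycle3 i j k)^-1 \in A by case: (cA i j k ij jk Tij Tjk) => // R; rewrite R in nR.
have nT : tperm i k \notin A by apply: contra nR => /(adm_TR admA ij jk)[].
case: (cA i j' k' ij' jk' Tij' Tjk') => // R.
have [T|nT'] := boolP (tperm i k' \in A); first by case: (adm_TR admA ij' jk' T).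
have [kk|/ltnW kk] := leqP k' k.
  case/negP: (nT'); have jk'' : j < k'.
    rewrite ltnNge; apply: contra nT' => k'j; apply: adm_nested Tij _ _ _ => //.
    exact: ltn_trans jk'.
  by apply: (bA i j' j k') => //; apply: adm_V_nested V _ _ _ _.
case/negP: (nT); have jk'' : j' < k.
  rewrite ltnNge; apply: contra nT => k'j; apply: adm_nested Tij' _ _ _ => //.
  exact: ltn_trans jk.
by apply: (bA i j' j k) => //; apply: adm_R_nested R _ _ _ _.
Qed.

End Admissible.

(** * Permutations fixing an initial segment, and multiplication by a cycle *)

Section Cyc.

Variable n : nat.
Implicit Types (s t p q : 'S_n) (x y z i j k l m : 'I_n) (A : {set 'S_n}).

Definition fixes_below (b : nat) s := forall x, x < b -> s x = x.

Lemma fixes_belowV b s : fixes_below b s -> fixes_below b s^-1.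
Proof. by move=> H x xb; rewrite -{1}(H x xb) permK. Qed.

Lemma reach_fixed b s (i z : nat) : fixes_below b s -> i < b -> i < n -> reach s i z = (z <= i).
Proof.
move=> fs ib i_n; apply/reachP/idP => [[x xi]|zi].
  by rewrite fs ?(leq_ltn_trans xi) // => /leq_trans; apply.
by apply/reachP; apply: reach_diag.
Qed.

(** By induction on x: s x <= x, and a value s x < x would already be fixed, hence taken twice. *)
Lemma fixes_of_reach b s :
  (forall i z, i < b -> reach s i z -> z <= i) -> fixes_below b s.
Proof.
move=> H x; have [c] := ubnP (x : nat); elim: c x => // c IH x xc xb.
have sx : s x <= x by apply: H xb _; apply: (@reachI _ _ _ _ x).
move: sx; rewrite leq_eqVlt => /orP[/eqP/val_inj //|sx].
by have /perm_inj // := IH (s x) (leq_trans sx xc) (ltn_trans sx xb).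
Qed.

(** [maxn] makes this a bijection, namely the identity, also for m < k. The default of [insubd]
    never occurs, the value being always below n. *)
Definition cyc_fun k m x : 'I_n :=
  insubd x (if x == k then maxn k m else if k < x <= m then x.-1 else x : nat).

Lemma cyc_funE k m x :
  val (cyc_fun k m x) = if x == k :> nat then maxn k m else if k < x <= m then x.-1 else x.
Proof.
rewrite val_insubd -val_eqE; case: ifP => // /negP[].
have := ltn_ord x; have := ltn_ord k; have := ltn_ord m; do ?case: ifP; lia.
Qed.

Lemma cyc_fun_inj k m : injective (cyc_fun k m).
Proof.
move=> x y /(congr1 val); rewrite !cyc_funE => E; apply: val_inj => /=.
move: E; do ?case: ifP; lia.
Qed.

(* The cycle m -> m - 1 -> ... -> k -> m; the identity for m <= k. *)
Definition cyc k m : 'S_n := perm (@cyc_fun_inj k m).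

Lemma cycE k m x : k <= m ->
  cyc k m x = (if x == k :> nat then m : nat else if k < x <= m then x.-1 else x) :> nat.
Proof. by move=> /maxn_idPr km; rewrite permE cyc_funE km. Qed.

Lemma cycVE k m y : k <= m ->
  (cyc k m)^-1 y = (if y == m :> nat then k : nat else if k <= y < m then y.+1 else y) :> nat.
Proof.
move=> km; rewrite -[y](permKV (cyc k m)); set x := (cyc k m)^-1 y.
rewrite permK cycE //.
by do ?case: ifP; lia.
Qed.

Lemma cyc_id k : cyc k k = 1.
Proof.
apply/permP => x; rewrite perm1; apply: val_inj; rewrite /= cycE //.
by do ?case: ifP; lia.
Qed.

Section Reach.

Variables (k m : 'I_n) (q : 'S_n).
Hypotheses (km : k <= m) (fq : fixes_below k.+1 q).
Let p := permcomp (cyc k m) q.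

Lemma cyc_fixes : fixes_below k p.
Proof.
move=> x xk; rewrite permcompE fq ?(ltnW xk) //; last exact: ltn_trans xk _.
apply: val_inj; rewrite /= cycE //; do ?case: ifP; lia.
Qed.

Lemma cyc_at : p k = m.
Proof. by apply: val_inj; rewrite permcompE fq // /= cycE // eqxx. Qed.

(** Since p k = m, all thresholds up to m are met at k; values above m are not moved by the
    cycle. *)
Lemma reach_cyc (i z : nat) : k <= i -> reach p i z = (z <= m) || reach q i z.
Proof.
move=> ki; apply/idP/orP => [/reachP[x xi]|[zm|/reachP[x xi zq]]].
- rewrite permcompE cycE // => H; have [zm|mz] := leqP z m; first by left.
  right; apply: (@reachI _ _ _ _ x) => //; move: H; do ?case: ifP; lia.
- by apply: (@reachI _ _ _ _ k); rewrite ?cyc_at.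
- have [zm|mz] := leqP z m; first by apply: (@reachI _ _ _ _ k); rewrite ?cyc_at.
  by apply: (@reachI _ _ _ _ x) => //; rewrite permcompE cycE //; do ?case: ifP; lia.
Qed.

Let pV x : p^-1 x = q^-1 ((cyc k m)^-1 x).
Proof. by rewrite /p /permcomp invMg permM. Qed.

Lemma reach_cycV_ge (i z : nat) : m <= i -> reach p^-1 i z = reach q^-1 i z.
Proof.
move=> mi; apply/reachP/reachP => [[y yi]|[y yi zy]].
  rewrite pV; exists ((cyc k m)^-1 y) => //; rewrite cycVE //; do ?case: ifP; lia.
exists (cyc k m y); last by rewrite pV permK.
by rewrite cycE //; do ?case: ifP; lia.
Qed.

(** For k <= i < m the inverse cycle maps {0,...,i} onto {0,...,i+1} without k, and k, fixed by [q],
    meets only thresholds up to k. *)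
Lemma reach_cycV_lt (i z : nat) : k <= i -> i < m -> reach p^-1 i z = reach q^-1 i.+1 z.
Proof.
move=> ki im; have i_n : i < n by apply: ltn_trans (ltn_ord m).
apply/idP/idP => /reachP[y yi].
  rewrite pV => zy; apply: reachI zy; rewrite cycVE //; do ?case: ifP; lia.
have [yk|ky] := leqP y k.
  by rewrite (fixes_belowV fq) // => zy; apply: reach_diag => //; lia.
move=> zy; apply: (@reachI _ _ _ _ (cyc k m y)); last by rewrite pV permK.
by rewrite cycE //; do ?case: ifP; lia.
Qed.

End Reach.

Lemma cyc_split k t : fixes_below k t ->
  [/\ k <= t k, fixes_below k.+1 (permcomp (cyc k (t k))^-1 t)
    & t = permcomp (cyc k (t k)) (permcomp (cyc k (t k))^-1 t)].
Proof.
move=> ft; have ktk : k <= t k.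
  by rewrite leqNgt; apply/negP => H; have /perm_inj E := ft _ H; move: H; rewrite E ltnn.
split=> // [x|]; last by rewrite /permcomp -mulgA mulVg mulg1.
rewrite ltnS leq_eqVlt => /orP[/eqP/val_inj->|xk]; apply: val_inj.
  by rewrite permcompE /= cycVE // eqxx.
rewrite permcompE (ft x) //= cycVE //; do ?case: ifP; lia.
Qed.

(** The factor [cyc k l] changes the rank only at heights b with k <= b < l: it maps {0,...,b+1}
    without k onto {0,...,b}, so the height becomes b + 1 and the point k is lost. *)
Lemma bruhat_cyc k m m' s t : k <= m -> m <= m' ->
  fixes_below k.+1 s -> fixes_below k.+1 t -> bruhat s t ->
  bruhat (permcomp (cyc k m) s) (permcomp (cyc k m') t).
Proof.
move=> km mm fs ft /bruhatP st; have km' := leq_trans km mm.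
have Ehi p l (a b : nat) : k <= l -> l <= b -> rank (permcomp (cyc k l) p) a b = rank p a b.
  move=> kl lb; apply: eq_card => x; rewrite !inE permcompE cycE //.
  by congr andb; do ?case: ifP; lia.
have Elow p l (a b : nat) : k <= l -> b < k -> rank (permcomp (cyc k l) p) a b = rank p a b.
  move=> kl lb; apply: eq_card => x; rewrite !inE permcompE cycE //.
  by congr andb; do ?case: ifP; lia.
have Emid p l (a b : nat) : fixes_below k.+1 p -> k <= l -> k <= a -> k <= b -> b < l ->
    (rank (permcomp (cyc k l) p) a b).+1 = rank p a b.+1.
  move=> fp kl ka kb bl; rewrite [RHS](cardsD1 k) inE ka fp // leqW // add1n.
  congr S; apply: eq_card => x; rewrite !inE permcompE cycE //.
  have -> : (x != k) = (p x != k :> nat).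
    by rewrite -{2}(fp k) // val_eqE (inj_eq perm_inj).
  by move: (p x : nat) => px; do ?case: ifP; lia.
apply/bruhatP => x y; have := st x y.
have [xk|kx] := ltnP x k.
  have E p l : fixes_below k.+1 p -> k <= l -> rank (permcomp (cyc k l) p) x y = rank p x y.
    move=> fp kl; apply: eq_card => z; rewrite !inE; apply: andb_id2l => zx.
    by rewrite cyc_fixes // ?fp //; lia.
  by rewrite !E.
have [yk|ky] := ltnP y k; first by rewrite !Elow.
have [my|ym] := leqP m' y; first by rewrite !Ehi ?(leq_trans mm).
have y1n : y.+1 < n by apply: leq_ltn_trans ym (ltn_ord _).
have := st x (Ordinal y1n) => /=.
rewrite -(Emid t m') //; have [my'|ym'] := leqP m y; last by rewrite -(Emid s m).
rewrite (Ehi s m) // => _ H.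
(* For m <= y < m' only the rank of [t] is shifted; one more unit of height adds at most one point,
   which the lost point k makes up for. *)
have E : rank t x y.+1 <= (rank t x y).+1.
  apply: (@leq_trans #|t^-1 (Ordinal y1n) |: [set z : 'I_n | (z <= x) && (t z <= y)]|).
    apply: subset_leq_card; apply/subsetP => z; rewrite !inE => /andP[-> /=].
    rewrite leq_eqVlt ltnS => /orP[/eqP E|->]; last exact: orbT.
    by apply/orP; left; apply/eqP/(@perm_inj _ t); rewrite permKV; apply: val_inj.
  by rewrite cardsU1; case: (_ \notin _) => /=; rewrite ?add1n ?add0n // leqnSn.
by have := Emid t m' x y ft km' kx ky ym; lia.
Qed.

End Cyc.

(** * Products along a compatible order *)

Section CompatibleProduct.

Variable n : nat.
Implicit Types (s t p q : 'S_n) (x y z i j k l m : 'I_n) (A : {set 'S_n}).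
Implicit Types (u v w : seq 'S_n).

Lemma permcomp_prod_nil : permcomp_prod [::] = 1 :> 'S_n.
Proof. by rewrite /permcomp_prod big_nil. Qed.

Lemma permcomp_prod_cons s w : permcomp_prod (s :: w) = permcomp s (permcomp_prod w).
Proof. by rewrite /permcomp_prod big_cons. Qed.

Lemma permcomp_prod_cat v w :
  permcomp_prod (v ++ w) = permcomp (permcomp_prod v) (permcomp_prod w).
Proof.
elim: v => [|s v IH]; first by rewrite permcomp_prod_nil /permcomp mulg1.
by rewrite cat_cons !permcomp_prod_cons IH /permcomp mulgA.
Qed.

Lemma permcomp_prod_rcons w s : permcomp_prod (rcons w s) = permcomp (permcomp_prod w) s.
Proof.
by rewrite -cats1 permcomp_prod_cat permcomp_prod_cons permcomp_prod_nil /permcomp mul1g.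
Qed.

Lemma permcomp_prod_rev w : (forall s, s \in w -> s^-1 = s) ->
  permcomp_prod (rev w) = (permcomp_prod w)^-1.
Proof.
elim: w => [|s w IH] H; first by rewrite permcomp_prod_nil invg1.
rewrite rev_cons permcomp_prod_rcons permcomp_prod_cons /permcomp invMg IH.
  by rewrite (H s) ?mem_head.
by move=> t tw; apply: H; rewrite inE tw orbT.
Qed.

Lemma tperm_eq x y i j : x < y -> i < j -> (tperm x y == tperm i j) = (x == i) && (y == j).
Proof.
move=> xy ij; apply/eqP/andP => [E|[/eqP-> /eqP->] //].
have := tpermL x y; have := tpermR x y; rewrite E.
do 2 case: tpermP; rewrite -?val_eqE /= => *; subst; try by rewrite eqxx in xy *.
all: try lia.
all: by rewrite ?eqxx // ltnn in xy *.
Qed.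

(** Writes b - a as a sum of indicators over all x, so that identities between counts can be checked
    separately for each x. *)
Lemma sum_interval (a b : nat) : a <= b -> b <= n ->
  (a + \sum_(x : 'I_n) (a <= x < b) = b)%N.
Proof.
move=> ab b_n.
have E c : c <= n -> (\sum_(x : 'I_n) (x < c : nat))%N = c.
  case: c => [|c] cn; first by rewrite big1.
  rewrite -[RHS](card_ord_le cn) -sum1_card [RHS]big_mkcond.
  by apply: eq_bigr => x _; rewrite inE ltnS; case: leqP.
rewrite -{1}(E a) ?(leq_trans ab) // -big_split -[RHS](E b) //=.
by apply: eq_bigr => x _; do 2 case: leqP; lia.
Qed.

Section FixedOrder.

Variables (A : {set 'S_n}) (prec : rel 'S_n) (k m : 'I_n).
Hypotheses (admA : admissible A) (compA : compatible A prec).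
Hypothesis fixA : forall s, s \in A -> fixes_below k s.
Hypothesis orA : R_oriented A k.
Hypothesis km : k <= m.
Hypothesis mP : forall j, k < j -> (tperm k j \in A) = (j <= m).

Let D := part_T A.

Lemma part_T_subset s : s \in D -> s \in A.
Proof. by rewrite inE => /andP[]. Qed.

Lemma adm_tperm_ge i j : i < j -> tperm i j \in A -> k <= i.
Proof.
move=> ij /fixA H; rewrite leqNgt; apply/negP => /H.
by rewrite tpermL => E; rewrite E ltnn in ij.
Qed.

Lemma adm_tperm_le i j : k <= i -> i < j -> j <= m -> tperm i j \in A.
Proof.
move=> ki ij jm; have kj := leq_ltn_trans ki ij.
by apply: (@adm_nested _ A admA k j); rewrite ?mP.
Qed.

Lemma prec_irr s : s \in D -> prec s s = false.
Proof. by case: compA => -[H _ _] _ /H/negPf. Qed.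

Lemma prec_trans s t p : s \in D -> t \in D -> p \in D -> prec s t -> prec t p -> prec s p.
Proof. by case: compA => -[_ H _] _ sD tD pD; apply: H. Qed.

Lemma prec_asym s t : s \in D -> t \in D -> prec s t -> prec t s = false.
Proof.
move=> sD tD st; apply/negP => ts.
by have := prec_trans sD tD sD st ts; rewrite prec_irr.
Qed.

Section Triple.

Variables i j l : 'I_n.
Hypotheses (ij : i < j) (jl : j < l).
Hypotheses (Tij : tperm i j \in A) (Tjl : tperm j l \in A) (Til : tperm i l \in A).

Let il : i < l. Proof. exact: ltn_trans jl. Qed.
Let Dij : tperm i j \in D. Proof. by rewrite part_TP. Qed.
Let Djl : tperm j l \in D. Proof. by rewrite part_TP. Qed.
Let Dil : tperm i l \in D. Proof. by rewrite part_TP. Qed.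

Let tri : prec (tperm i j) (tperm i l) /\ prec (tperm i l) (tperm j l) \/
       prec (tperm j l) (tperm i l) /\ prec (tperm i l) (tperm i j).
Proof. by case: compA => _ /(_ i j l ij jl Tij Tjl) [/(_ Til)]. Qed.

(** Seen from T_{i,l}, the other two transpositions of the triple lie on opposite sides; seen from
    T_{i,j} ([prec_lo]) or T_{j,l} ([prec_hi]), the other two lie on the same side. *)
Lemma prec_mid : prec (tperm i j) (tperm i l) = ~~ prec (tperm j l) (tperm i l).
Proof.
case: tri => -[H1 H2]; first by rewrite H1 (prec_asym Dil Djl H2).
by rewrite H1 (prec_asym Dil Dij H2).
Qed.

Lemma prec_lo : prec (tperm i l) (tperm i j) = prec (tperm j l) (tperm i j).
Proof.
case: tri => -[H1 H2]; last by rewrite H2 (prec_trans Djl Dil Dij).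
by rewrite (prec_asym Dij Dil H1) (prec_asym Dij Djl (prec_trans Dij Dil Djl H1 H2)).
Qed.

Lemma prec_hi : prec (tperm i j) (tperm j l) = prec (tperm i l) (tperm j l).
Proof.
case: tri => -[H1 H2]; first by rewrite H2 (prec_trans Dij Dil Djl).
by rewrite (prec_asym Djl (Dil) H1) (prec_asym Djl Dij (prec_trans Djl Dil Dij H1 H2)).
Qed.

End Triple.

(** The prefixes of an increasing enumeration of [D], described without the rest of the list so that
    one can induct on the last entry. *)
Definition initial v := {subset v <= D} /\
  forall u s u', v = rcons u s ++ u' -> {in D, forall t, (t \in u) = prec t s}.

Lemma initial_rcons u s : initial (rcons u s) ->
  [/\ initial u, s \in D & {in D, forall t, (t \in u) = prec t s}].
Proof.
case=> sub H; split.
- split=> [t tu|u' s' v' E]; first by apply: sub; rewrite mem_rcons inE tu orbT.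
  by apply: (H _ _ (rcons v' s)); rewrite E rcons_cat.
- by apply: sub; rewrite mem_rcons mem_head.
- by apply: (H _ _ [::]); rewrite cats0.
Qed.

Lemma sorted_initial w : perm_eq w (enum D) -> sorted prec w -> initial w.
Proof.
move=> wD; have wE t : (t \in w) = (t \in D) by rewrite (perm_mem wD) mem_enum.
have allD : all (mem D) w by apply/allP => t; rewrite wE.
case: (compA) => -[_ tr _] _; rewrite (sorted_pairwise_in tr allD) => pw.
split=> [t|u s u' E t tD]; first by rewrite wE.
have sD : s \in D by rewrite -wE E mem_cat mem_rcons mem_head.
move: pw; rewrite E pairwise_cat pairwise_rcons => /and3P[/allrelP H1 /andP[/allP H2 _] _].
apply/idP/idP => [/H2 //|ts]; move: (tD).
rewrite -wE E mem_cat mem_rcons inE -orbA => /or3P[/eqP Et|//|tz].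
  by move: ts; rewrite Et prec_irr.
by move: (prec_asym tD sD ts); rewrite H1 // mem_rcons mem_head.
Qed.

(* As for a prefix of a reflection order, the product sends j to j + #{x > j} -
   #{x < j}, where x ranges over the indices with T_{j,x} in v; both sides are
   arranged so that no subtraction occurs. *)
Lemma initial_prodE v j : initial v -> k <= j -> j <= m ->
  (j != k -> tperm k j \notin v) ->
  (permcomp_prod v j + \sum_(x : 'I_n) [&& k <= x, x < j & tperm x j \in v] =
   j + \sum_(x : 'I_n) [&& j < x, x <= m & tperm j x \in v])%N.
Proof.
elim/last_ind: v j => [|u s IH] j iv kj jm nj.
  rewrite permcomp_prod_nil perm1; congr (_ + _)%N.
  by rewrite !big1 // => x _; rewrite in_nil !andbF.
have [iu sD uE] := initial_rcons iv; have sT := sD.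
have su : (s \in u) = false by rewrite uE ?prec_irr.
have sv : s \in rcons u s by rewrite mem_rcons mem_head.
move: sD; rewrite inE => /andP[sA /transpositionsP[a [b [ab sE]]]].
have ka : k <= a by apply: adm_tperm_ge ab _; rewrite -sE.
have uP x y : x < y -> tperm x y \in A -> (tperm x y \in u) = prec (tperm x y) s.
  by move=> xy xyA; rewrite uE // part_TP.
have vP x y : x < y -> tperm x y \in A ->
    (tperm x y \in rcons u s) = (x == a :> nat) && (y == b :> nat) || prec (tperm x y) s.
  by move=> xy xyA; rewrite mem_rcons inE uP // {1}sE tperm_eq // -!val_eqE.
have nju : j != k -> tperm k j \notin u.
  by move=> /nj; apply: contra; rewrite mem_rcons inE orbC => ->.
have nkjs : j != k -> tperm k j != s.
  by move=> /nj; apply: contra => /eqP->; rewrite mem_rcons mem_head.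
have jk : (j != k) = (k < j) by rewrite ltn_neqAle kj andbT eq_sym.
rewrite permcomp_prod_rcons permcompE.
(* The last factor T_{a,b} acts first. If j = a, then j goes to b, and the induction hypothesis is
   applied at b. *)
have [ja|ja] := eqVneq j a.
  subst a; have kb := leq_ltn_trans ka ab.
  (* If m < b, then k < j and T_{k,b} is not in A, while R_{k,j,b} is by orientation. Compatibility
     then puts T_{k,j} before [s], against [nju]. *)
  have bm : b <= m.
    rewrite leqNgt; apply/negP => mb.
    have kj' : k < j.
      rewrite ltn_neqAle kj andbT; apply/eqP => /val_inj E.
      by move: sA; rewrite sE -E mP // leqNgt mb.
    have Tkj : tperm k j \in A by rewrite mP.
    have Tjb : tperm j b \in A by rewrite -sE.
    have nTkb : tperm k b \notin A by rewrite mP // -ltnNge.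
    case: compA => _ /(_ k j b kj' ab Tkj Tjb) [_ /(_ nTkb) [/(_ (orA kj' ab Tkj Tjb)) pr _]].
    by move: nju; rewrite jk kj' uP // sE pr => /(_ isT).
  have IHb : (permcomp_prod u b + \sum_(x : 'I_n) [&& k <= x, x < b & tperm x b \in u] =
   b + \sum_(x : 'I_n) [&& b < x, x <= m & tperm b x \in u])%N.
    apply: IH => //; first exact: ltnW.
    move=> _; have [jk'|/eqP jk'] := eqVneq j k; first by rewrite -jk' -sE su.
    move/eqP: jk'; rewrite jk => jk'.
    rewrite uP ?mP // sE -prec_hi ?mP ?adm_tperm_le // -sE -uP ?mP //.
    by apply: nju; rewrite jk.
  rewrite sE tpermL -sE.
  move: IHb; have := sum_interval (ltnW ab : j.+1 <= b.+1) (ltn_ord b).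
  (* For j < x < b exactly one of T_{j,x}, T_{x,b} precedes [s]; x = b accounts for [s] itself; for
     x < j or x > b the terms agree by [prec_hi] and [prec_lo]. *)
  suff : (\sum_(x : 'I_n) (j < x < b.+1) +
          \sum_(x : 'I_n) [&& b < x, x <= m & tperm b x \in u] +
          \sum_(x : 'I_n) [&& k <= x, x < j & tperm x j \in rcons u s] =
          \sum_(x : 'I_n) [&& j < x, x <= m & tperm j x \in rcons u s] +
          \sum_(x : 'I_n) [&& k <= x, x < b & tperm x b \in u])%N.
    by do !move: (bigop _ _ _) => ?; lia.
  have kb' := ltnW kb; rewrite -!big_split; apply: eq_bigr => x _ /=; rewrite ltnS.
  have [xb|bx|/val_inj->] := ltngtP x b; last first.
  - by rewrite ab bm -sE sv [b < j]ltnNge (ltnW ab) !andbF.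
  - have jx := ltn_trans ab bx; rewrite jx [x < j]ltnNge (ltnW jx) !andbF /= addn0.
    case: (leqP x m) => //= xm.
    by rewrite vP ?uP ?adm_tperm_le // (gtn_eqF bx) andbF sE addn0 prec_lo ?adm_tperm_le.
  have [xj|jx|/val_inj->] := ltngtP x j; last first.
  - by rewrite -sE su /= !andbF.
  - have xm := leq_trans (ltnW xb) bm; have kx := leq_trans kj (ltnW jx).
    rewrite xm kx /= vP ?uP ?adm_tperm_le // (ltn_eqF xb) andbF sE.
    by rewrite prec_mid ?adm_tperm_le //; case: prec.
  - case: (leqP k x) => //= kx.
    by rewrite vP ?uP ?adm_tperm_le // (ltn_eqF xj) /= sE prec_hi ?adm_tperm_le.
have [jb|jb] := eqVneq j b.
  (* With a = k the last entry would be T_{k,j}, which is not in the list. *)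
  subst b; have ka' : k < a.
    rewrite ltn_neqAle ka andbT; apply/eqP => /val_inj E.
    by have := nkjs; rewrite jk sE E ab eqxx => /(_ isT).
  have am := leq_trans (ltnW ab) jm; have kj' := ltn_trans ka' ab.
  have IHa : (permcomp_prod u a + \sum_(x : 'I_n) [&& k <= x, x < a & tperm x a \in u] =
   a + \sum_(x : 'I_n) [&& a < x, x <= m & tperm a x \in u])%N.
    apply: IH => // _; move: nju; rewrite jk kj' !uP ?mP // => /(_ isT).
    by rewrite sE prec_hi ?mP ?adm_tperm_le.
  rewrite sE tpermR -sE.
  move: IHa; have := sum_interval (ltnW ab) (ltnW (ltn_ord j)).
  suff : (\sum_(x : 'I_n) [&& a < x, x <= m & tperm a x \in u] +
          \sum_(x : 'I_n) [&& k <= x, x < j & tperm x j \in rcons u s] =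
          \sum_(x : 'I_n) (a <= x < j) +
          \sum_(x : 'I_n) [&& j < x, x <= m & tperm j x \in rcons u s] +
          \sum_(x : 'I_n) [&& k <= x, x < a & tperm x a \in u])%N.
    by do !move: (bigop _ _ _) => ?; lia.
  rewrite -!big_split; apply: eq_bigr => x _ /=.
  have [xj|jx|/val_inj->] := ltngtP x j; last first.
  - by rewrite -sE su /= !andbF ltnNge (ltnW ab) !andbF.
  - have ax := ltn_trans ab jx; rewrite ax [x < a]ltnNge (ltnW ax) !andbF /= !addn0.
    case: (leqP x m) => //= xm.
    by rewrite vP ?uP ?adm_tperm_le // (gtn_eqF ab) /= sE prec_lo ?adm_tperm_le.
  have [xa|ax|/val_inj->] := ltngtP x a; last first.
  - by rewrite ka -sE sv andbF.
  - have xm := leq_trans (ltnW xj) jm; have kx := leq_trans ka (ltnW ax).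
    rewrite xm kx /= vP ?uP ?adm_tperm_le // (gtn_eqF ax) /= sE.
    by rewrite prec_mid ?adm_tperm_le //; case: prec.
  - case: (leqP k x) => //= kx.
    by rewrite vP ?uP ?adm_tperm_le // (ltn_eqF xa) /= sE prec_hi ?adm_tperm_le.
rewrite sE tpermD 1?eq_sym // -sE.
have -> : (\sum_(x : 'I_n) [&& k <= x, x < j & tperm x j \in rcons u s] =
           \sum_(x : 'I_n) [&& k <= x, x < j & tperm x j \in u])%N.
  apply: eq_bigr => x _; congr nat_of_bool; congr andb; apply: andb_id2l => xj.
  by rewrite mem_rcons inE sE tperm_eq // (negPf jb) andbF.
have -> : (\sum_(x : 'I_n) [&& j < x, x <= m & tperm j x \in rcons u s] =
           \sum_(x : 'I_n) [&& j < x, x <= m & tperm j x \in u])%N.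
  apply: eq_bigr => x _; congr nat_of_bool; apply: andb_id2l => xj; congr andb.
  by rewrite mem_rcons inE sE tperm_eq // (negPf ja).
exact: IH.
Qed.

Lemma initial_prod_k v : initial v ->
  (permcomp_prod v k = k + \sum_(x : 'I_n) [&& k < x, x <= m & tperm k x \in v] :> nat)%N.
Proof.
move=> iv; rewrite -initial_prodE //; last by rewrite eqxx.
by rewrite big1 ?addn0 // => x _; case: ltngtP.
Qed.

(** Hence T_{k,j}, moved to the front across the product c of the entries before it, becomes the
    transposition of the consecutive values c k and c k + 1. Both values come from the counting
    formula, and the counts are matched through the triples formed by k, j and x. *)
Lemma initial_prod_prec v s j : initial (rcons v s) -> s = tperm k j -> k < j ->
  permcomp_prod v j = (permcomp_prod v k).+1 :> nat.
Proof.
move=> iv sE kj; have [iu sD uE] := initial_rcons iv.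
have su : (s \in v) = false by rewrite uE ?prec_irr.
have jm : j <= m by rewrite -mP // -sE part_T_subset.
have uP x y : x < y -> tperm x y \in A -> (tperm x y \in v) = prec (tperm x y) s.
  by move=> xy xyA; rewrite uE // part_TP.
have := initial_prodE iu (ltnW kj) jm; rewrite -sE su => /(_ (fun _ => isT)).
have := initial_prod_k iu.
have := sum_interval kj (ltnW (ltn_ord j)).
suff : (\sum_(x : 'I_n) (k < x < j) +
        \sum_(x : 'I_n) [&& j < x, x <= m & tperm j x \in v] =
        \sum_(x : 'I_n) [&& k < x, x <= m & tperm k x \in v] +
        \sum_(x : 'I_n) [&& k <= x, x < j & tperm x j \in v])%N.
    by do !move: (bigop _ _ _) => ?; lia.
rewrite -!big_split; apply: eq_bigr => x _ /=.
have [xj|jx|/val_inj->] := ltngtP x j; last first.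
- by rewrite -sE su !andbF.
- have kx := ltn_trans kj jx; rewrite kx !andbF addn0 /=.
  case: (leqP x m) => //= xm.
  have kj' := ltnW kj.
  by rewrite add0n !uP ?adm_tperm_le // sE prec_lo ?adm_tperm_le.
have [xk|kx|/val_inj->] := ltngtP x k => //; last by rewrite -sE su.
have xm := leq_trans (ltnW xj) jm; have kx' := ltnW kx.
by rewrite xm /= !uP ?adm_tperm_le // sE prec_mid ?adm_tperm_le //; case: prec.
Qed.

Lemma cyc_succ i j l : i <= j -> l = j.+1 :> nat -> cyc i l = permcomp (tperm j l) (cyc i j).
Proof.
move=> ij lj; have jl : j < l by rewrite lj.
have il := leq_trans ij (ltnW jl); apply/permP => x; apply: val_inj => /=.
rewrite permcompE cycE //; case: tpermP => [E|E|/eqP + /eqP].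
- by move/(congr1 val): E => /=; rewrite cycE //; do ?case: ifP; lia.
- by move/(congr1 val): E => /=; rewrite cycE //; do ?case: ifP; lia.
- by rewrite -!val_eqE /= cycE //; do ?case: ifP; lia.
Qed.

(** Each new T_{k,j}, moved to the front, lengthens the cycle by one step ([cyc_succ]); an entry
    fixing k joins the remaining product. *)
Lemma initial_prod_cyc v : initial v ->
  permcomp_prod v =
  permcomp (cyc k (permcomp_prod v k)) (permcomp_prod [seq s : 'S_n <- v | s k == k]).
Proof.
elim/last_ind: v => [|v s IH] iv.
  by rewrite permcomp_prod_nil perm1 cyc_id /permcomp mulg1.
have [iu sD uE] := initial_rcons iv.
move: (sD); rewrite inE => /andP[sA /transpositionsP[a [b [ab sE]]]].
have ka : k <= a by apply: adm_tperm_ge ab _; rewrite -sE.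
rewrite filter_rcons !permcomp_prod_rcons permcompE; case: ifPn => [/eqP sk|sk].
  by rewrite sk permcomp_prod_rcons {1}(IH iu) /permcomp mulgA.
have ak : a = k.
  apply: contraNeq sk => ak; have ka' : k < a by rewrite ltn_neqAle ka andbT eq_sym.
  by rewrite sE tpermD // -val_eqE gtn_eqF ?(ltn_trans ka').
subst a; have E := initial_prod_prec iv sE ab.
rewrite sE tpermL (cyc_succ _ E); last first.
  by rewrite initial_prod_k // leq_addr.
have E2 := IH iu; set c := permcomp_prod v in E E2 *.
have -> : forall t r, permcomp (permcomp t (cyc k (c k))) r = permcomp t (permcomp (cyc k (c k)) r).
  by move=> t r; rewrite /permcomp mulgA.
rewrite -E2; apply/permP => x; rewrite !permcompE.
have [->|xk] := eqVneq x k; first by rewrite !tpermL.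
have [->|xb] := eqVneq x b; first by rewrite !tpermR.
by rewrite !tpermD // ?(inj_eq perm_inj) 1?eq_sym.
Qed.

Lemma sorted_prod_cyc w : perm_eq w (enum D) -> sorted prec w ->
  permcomp_prod w = permcomp (cyc k m) (permcomp_prod [seq s : 'S_n <- w | s k == k]).
Proof.
move=> wD sw; have iw := sorted_initial wD sw; rewrite {1}(initial_prod_cyc iw).
congr (permcomp (cyc k _) _); apply: val_inj => /=.
have := initial_prod_k iw.
have := sum_interval (km : k.+1 <= m.+1) (ltn_ord m).
(* The full list contains every T_{k,x} with k < x <= m, so its product sends k to m. *)
suff -> : (\sum_(x : 'I_n) [&& k < x, x <= m & tperm k x \in w] =
           \sum_(x : 'I_n) (k < x < m.+1))%N.
    by do !move: (bigop _ _ _) => ?; lia.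
apply: eq_bigr => x _; congr nat_of_bool; apply: andb_id2l => kx; rewrite ltnS.
apply: andb_idr => xm; by rewrite (perm_mem wD) mem_enum part_TP ?mP.
Qed.

End FixedOrder.
End CompatibleProduct.

(** * The greatest permutation with a given set below it *)

Section Greatest.

Variable n : nat.
Implicit Types (s t p q : 'S_n) (x y z i j k l m : 'I_n) (A : {set 'S_n}).
Implicit Types (w : seq 'S_n) (prec : rel 'S_n).

(* If u(i) = max {r | U i r} and l(i) is defined likewise, this says that
   l(i) = l(u(i)) whenever u(i) < l(i). *)
Definition stretched (U L : nat -> nat -> bool) := forall i m x y,
  U i m -> ~~ U i y -> L i y -> L m x -> L i x.

Lemma ord_succ m x : m < x -> exists y, y = m.+1 :> nat.
Proof. by move=> mx; exists (Ordinal (leq_ltn_trans mx (ltn_ord x))). Qed.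

(** Induction on n - i. If [t] but not [p] reaches x from i, then T_{i,x} is not below [t], so m =
    l_t(i) < x. The sets below [t] and [p] being equal, l_p(i) = m < u_p(i). By induction [p]
    reaches x from m, and stretchedness carries this back to i. *)
Lemma below_reach t p i x : below t = below p -> stretched (reach p^-1) (reach p) ->
  reach t i x -> reach p i x.
Proof.
move=> E S; have [c] := ubnP (n - i); elim: c i x => // c IH i x ic Utx.
apply: contraT => nUpx.
have ix : i < x by rewrite ltnNge; apply: contra nUpx; apply: reach_diag.
have T_tp (a b : 'I_n) : a < b -> reach t a b && reach t^-1 a b = reach p a b && reach p^-1 a b.
  by move=> ab; rewrite -!(mem_belowT _ ab) E.
have nLtx : ~~ reach t^-1 i x.
  by apply: contra nUpx => Ltx; have := T_tp i x ix; rewrite Utx Ltx => /esym/andP[].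
have [m [im Ltm nLtm]] := reach_max t^-1 i.
have mx : m < x by rewrite ltnNge; apply: contra nLtx => xm; apply: reach_le Ltm _ _.
(* m = l_t(i) and y = m + 1, so that R_{i,m,y}^-1 <= t but T_{i,y} is not. *)
have [y yE] := ord_succ mx; rewrite -yE in nLtm.
have Uty : reach t i y by apply: reach_le Utx _ _; rewrite ?yE.
(* If m = i, then [t^-1] preserves {0,...,i}, hence so does [t], against [Uty]. *)
have {}im : i < m.
  rewrite ltn_neqAle im andbT; apply/eqP => /val_inj E'; subst m.
  by move: nLtm; rewrite yE reach_succV -yE Uty.
have my : m < y by rewrite yE.
have Utm : reach t i m by apply: reach_le Utx _ _; rewrite // ltnW.
have Lty : reach t^-1 m y.
  by rewrite yE reach_succV -yE; apply: reach_le Uty _ _; rewrite // ltnW.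
have /and3P[Lpm Lpy Upy] : [&& reach p^-1 i m, reach p^-1 m y & reach p i y].
  by rewrite -mem_belowV // -E mem_belowV // Ltm Lty Uty.
have nLpy : ~~ reach p^-1 i y.
  by apply: contra nLtm => H; have := T_tp i y (ltn_trans im my); rewrite H Upy => /andP[].
have Upmx : reach p m x.
  apply: IH; first by have mn := ltn_ord m; clear -ic im mn; lia.
  by apply: reach_le Utx _ _; rewrite // ltnW.
by rewrite (S _ _ _ _ Lpm nLpy Upy Upmx) in nUpx.
Qed.

(** The induction invariant. Stretchedness bounds u and l of any [t] with the same set below it by
    those of [p]; [good_max] turns these bounds into t <= p. *)
Record good (b : nat) A p : Prop := Good {
  good_fixes : fixes_below b p;
  good_below : below p = A;
  good_U : stretched (reach p^-1) (reach p);
  good_L : stretched (reach p) (reach p^-1);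
  good_max : forall t, (forall i x, reach t i x -> reach p i x) ->
    (forall i x, reach t^-1 i x -> reach p^-1 i x) -> bruhat t p;
  good_order : exists prec, compatible A prec;
  good_prod : forall prec w, compatible A prec -> perm_eq w (enum (part_T A)) ->
    sorted prec w -> permcomp_prod w = p }.

Lemma good_is_adm_pi b A p : good b A p -> is_adm_pi A p.
Proof.
case=> _ Ep U L mx _ _; rewrite /is_adm_pi Ep eqxx; apply/forallP => t; apply/implyP => /eqP Et.
apply: mx => i x; first by apply: below_reach U; rewrite Et Ep.
by apply: below_reach; rewrite ?belowV ?Et ?Ep // invgK.
Qed.

Lemma part_TV A : part_T A^-1 = part_T A.
Proof.
apply/setP => s; rewrite !inE; apply: andb_id2r.
by case/existsP => i /existsP[j /andP[_ /eqP->]]; rewrite tpermV.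
Qed.

(** If T_{i,k} is not in A, then (c), and (b) with both middle indices equal to j, leave exactly one
    of R_{i,j,k} and its inverse in A. So inversion of A matches reversal of the order. *)
Lemma compatibleV A prec : admissible A -> compatible A prec ->
  compatible A^-1 (fun s t => prec t s).
Proof.
move=> admA [[irr tr tot] H]; case: (admA) => _ _ bA cA; split.
  rewrite part_TV; split=> //; first by move=> s t p sD tD pD H1 H2; apply: (tr s p t).
  by move=> s t sD tD st; apply: tot; rewrite // eq_sym.
move=> i j k ij jk; rewrite !mem_invg !tpermV => Tij Tjk.
have [H1 H2] := H i j k ij jk Tij Tjk; split=> [/H1[][]|nT]; first by [right|left].
  by left.
have [H3 H4] := H2 nT; have ik := ltn_trans ij jk.
have Dij : tperm i j \in part_T A by rewrite part_TP.
have Djk : tperm j k \in part_T A by rewrite part_TP.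
split=> [V|pr].
  have ne : tperm j k != tperm i j by rewrite tperm_eq // -val_eqE /= (gtn_eqF ij).
  have /orP[//|/H4 R] := tot _ _ Djk Dij ne.
  by case/negP: nT; apply: (bA i j j k).
case: (cA i j k ij jk Tij Tjk) => // /H3 pr'.
by have := irr _ Dij; rewrite (tr _ _ _ Djk Dij Dij pr' pr).
Qed.

Lemma goodV b A p : admissible A -> good b A^-1 p^-1 -> good b A p.
Proof.
move=> admA [fp Ep U L mx [prec co] pr]; split.
- by rewrite -[p]invgK; apply: fixes_belowV.
- by rewrite -[p]invgK belowV Ep invgK.
- by move: L; rewrite invgK.
- by move: U; rewrite invgK.
- by move=> t H H'; rewrite -bruhatV; apply: mx; rewrite // !invgK.
- exists (fun s t => prec t s); rewrite -[A]invgK; apply: compatibleV => //.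
  exact: admissibleV.
- move=> prec' w co' wD sw; rewrite -[p]invgK; apply: canRL (@invgK _) _.
  rewrite -permcomp_prod_rev; last first.
    move=> s; rewrite (perm_mem wD) mem_enum inE => /andP[_ /transpositionsP[i [j [_ ->]]]].
    exact: tpermV.
  apply: (pr _ _ (compatibleV admA co')); last by rewrite rev_sorted.
  by rewrite part_TV; rewrite perm_rev.
Qed.

End Greatest.

(** * From the elements of A fixing k to all of A *)

Section Step.

Variable n : nat.
Implicit Types (s t p : 'S_n) (x y z i j l : 'I_n) (w : seq 'S_n) (prec : rel 'S_n).
Variables (A : {set 'S_n}) (k : 'I_n).
Hypotheses (admA : admissible A) (fixA : forall s, s \in A -> fixes_below k s).

Definition stabilized := [set s in A | s k == k].
Let A' := stabilized.

Lemma stabilized_fixes s : s \in A' -> fixes_below k.+1 s.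
Proof.
rewrite inE => /andP[sA /eqP sk] x; rewrite ltnS leq_eqVlt => /orP[/eqP/val_inj->//|].
exact: fixA.
Qed.

Lemma stabilized_T i j : i < j -> (tperm i j \in A') = (tperm i j \in A) && (k < i).
Proof.
move=> ij; rewrite inE; apply: andb_id2l => Tij; have := adm_tperm_ge fixA ij Tij.
rewrite leq_eqVlt => /orP[/eqP/val_inj ki|ki].
  by rewrite ki tpermL ltnn -val_eqE /= gtn_eqF.
by rewrite ki tpermD ?eqxx // -val_eqE /= gtn_eqF // (ltn_trans ki).
Qed.

Lemma stabilized_R i j l : i < j -> j < l ->
  (cycle3 i j l \in A') = (cycle3 i j l \in A) && (k < i).
Proof.
move=> ij jl; rewrite inE; apply: andb_id2l => R.
have [Tij _] := adm_RT admA ij jl R; have := adm_tperm_ge fixA ij Tij.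
have [ci _ _ cx] := cycle3E ij jl.
rewrite leq_eqVlt => /orP[/eqP/val_inj ki|ki].
  by rewrite ki ci ltnn -val_eqE /= gtn_eqF.
have kj := ltn_trans ki ij; have kl := ltn_trans kj jl.
by rewrite ki cx ?eqxx // -val_eqE /= ltn_eqF.
Qed.

Lemma stabilized_V i j l : i < j -> j < l ->
  ((cycle3 i j l)^-1 \in A') = ((cycle3 i j l)^-1 \in A) && (k < i).
Proof.
move=> ij jl; rewrite inE; apply: andb_id2l => V.
have [Tij _] := adm_VT admA ij jl V; have := adm_tperm_ge fixA ij Tij.
have [ci _ _ cx] := cycle3VE ij jl.
rewrite leq_eqVlt => /orP[/eqP/val_inj ki|ki].
  by rewrite ki ci ltnn -val_eqE /= gtn_eqF // (ltn_trans ij).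
have kj := ltn_trans ki ij; have kl := ltn_trans kj jl.
by rewrite ki cx ?eqxx // -val_eqE /= ltn_eqF.
Qed.

Lemma stabilized_admissible : admissible A'.
Proof.
case: (admA) => sA dA bA cA; split.
- by apply/subsetP => s; rewrite inE => /andP[/(subsetP sA)].
- move=> s t sA' tC ts; rewrite inE (dA s) //=; last by move: sA'; rewrite inE => /andP[].
  (* Whatever lies below a permutation fixing 0,...,k inherits its bounds on reach, hence fixes
     these points. *)
  apply/eqP; apply: (@fixes_of_reach _ k.+1); last exact: ltnSn.
  move=> i z ik /(bruhat_reach ts); rewrite (@reach_fixed _ k.+1) //.
  exact: stabilized_fixes.
- move=> i j l r ij jr il lr.
  rewrite stabilized_R // stabilized_V // stabilized_T ?(ltn_trans ij) //.
  move=> /andP[R ->] /andP[V _]; rewrite andbT; exact: (bA i j l r).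
- move=> i j l ij jl; rewrite !stabilized_T // stabilized_R // stabilized_V //.
  by move=> /andP[Tij ->] /andP[Tjl _]; rewrite !andbT; apply: cA.
Qed.

Lemma top_exists : exists m : 'I_n, k <= m /\ forall j, k < j -> (tperm k j \in A) = (j <= m).
Proof.
have Pk : (k == k) || (k < k) && (tperm k k \in A) by rewrite eqxx.
have := @arg_maxnP 'I_n k (fun j => (j == k) || (k < j) && (tperm k j \in A)) val Pk.
case=> m Pm mx; have km : k <= m by apply: mx.
exists m; split=> // j kj; apply/idP/idP => [T|jm].
  by apply: mx; rewrite kj T orbT.
have : m != k by rewrite -val_eqE /= gtn_eqF // (leq_trans kj).
move: Pm; rewrite orbC; case: eqP => //= _; rewrite orbF => /andP[km' T] _.
exact: adm_nested T _ _ _.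
Qed.

Lemma compatible_stabilized prec : compatible A prec -> compatible A' prec.
Proof.
case=> -[irr tr tot] H; have sub s : s \in part_T A' -> s \in part_T A.
  by rewrite !inE => /andP[/andP[-> _]].
split; first split.
- by move=> s /sub/irr.
- by move=> s t p /sub sD /sub tD /sub pD; apply: tr.
- by move=> s t /sub sD /sub tD; apply: tot.
move=> i j l ij jl; have il := ltn_trans ij jl.
rewrite !stabilized_T // stabilized_R // => /andP[Tij ->] /andP[Tjl _]; rewrite !andbT.
exact: H.
Qed.

Hypothesis orA : R_oriented A k.

(** The transpositions moving k come first; since T_{k,j} sends k to j, they are sorted by j. *)
Definition extend_order prec s t :=
  if s k == k then (t k == k) && prec s t else (t k == k) || (s k < t k).

Lemma part_T_moving s : s \in part_T A -> s k != k -> exists2 j : 'I_n, k < j & s = tperm k j.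
Proof.
rewrite inE => /andP[sA /transpositionsP[i [j [ij E]]]]; subst s => ne.
have := adm_tperm_ge fixA ij sA; rewrite leq_eqVlt => /orP[/eqP/val_inj ki|ki].
  by exists j; rewrite ki.
by move: ne; rewrite tpermD ?eqxx // -val_eqE /= gtn_eqF // (ltn_trans ki).
Qed.

Lemma extend_compatible prec : compatible A' prec -> compatible A (extend_order prec).
Proof.
case=> -[irr tr tot] H; have D' s : s \in part_T A -> s k == k -> s \in part_T A'.
  by rewrite !inE => /andP[-> ->] ->.
split; first split.
- move=> s sD; rewrite /extend_order; have [sk|_] := boolP (s k == k); last by rewrite ltnn.
  by apply: irr; apply: D'.
- move=> t s p tD sD pD; rewrite /extend_order.
  have [sk|sk] := boolP (s k == k); have [tk|tk] := boolP (t k == k) => //=;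
    have [pk|pk] := boolP (p k == k) => //=; try by [].
    by apply: tr; apply: D'.
  exact: ltn_trans.
- move=> s t sD tD st; rewrite /extend_order.
  have [sk|sk] := boolP (s k == k); have [tk|tk] := boolP (t k == k) => //=.
    by apply: tot; rewrite ?D'.
  have [i ki sE] := part_T_moving sD sk; have [j kj tE] := part_T_moving tD tk.
  rewrite sE tE !tpermL -neq_ltn; apply: contraNneq st => /val_inj E.
  by rewrite sE tE E.
move=> i j l ij jl Tij Tjl; have il := ltn_trans ij jl.
have := adm_tperm_ge fixA ij Tij; rewrite leq_eqVlt => /orP[/eqP/val_inj ki|ki].
  subst i; rewrite /extend_order !tpermL.
  have [kj kl] : (j == k) = false /\ (l == k) = false by rewrite -!val_eqE /= !gtn_eqF.
  rewrite kj kl tpermD ?kj ?kl // eqxx jl /=; split=> [_|_]; first by left.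
  by split=> // _; apply: orA.
have ki' x : k < x -> (x != k) by move=> kx; rewrite -val_eqE /= gtn_eqF.
have [kj kl] : k < j /\ k < l by rewrite !(ltn_trans ki).
rewrite /extend_order !tpermD ?ki' // eqxx /=.
have := H i j l ij jl; rewrite !stabilized_T // stabilized_R // ki kj !andbT.
by move/(_ Tij Tjl).
Qed.

Variables (q : 'S_n) (m : 'I_n).
Hypotheses (goodq : good k.+1 A' q) (km : k <= m).
Hypothesis mP : forall j, k < j -> (tperm k j \in A) = (j <= m).

Let fq : fixes_below k.+1 q. Proof. by case: goodq. Qed.
Let p := permcomp (cyc k m) q.

Let qT i j : k < i -> i < j -> reach q i j && reach q^-1 i j = (tperm i j \in A).
Proof.
move=> ki ij; rewrite -mem_belowT //; case: goodq => _ -> *.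
by rewrite stabilized_T // ki andbT.
Qed.

Let qR i j l : k < i -> i < j -> j < l ->
  [&& reach q i j, reach q j l & reach q^-1 i l] = (cycle3 i j l \in A).
Proof.
move=> ki ij jl; rewrite -mem_belowR //; case: goodq => _ -> *.
by rewrite stabilized_R // ki andbT.
Qed.

Let qV i j l : k < i -> i < j -> j < l ->
  [&& reach q^-1 i j, reach q^-1 j l & reach q i l] = ((cycle3 i j l)^-1 \in A).
Proof.
move=> ki ij jl; rewrite -mem_belowV //; case: goodq => _ -> *.
by rewrite stabilized_V // ki andbT.
Qed.

Let qm i : k < i -> i <= m -> reach q i m /\ reach q^-1 i m.
Proof.
move=> ki; rewrite leq_eqVlt => /orP[/eqP/val_inj->|im].
  by rewrite !reach_diag.
have T : tperm i m \in A by apply: (adm_tperm_le admA mP); rewrite // ltnW.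
by move: T; rewrite -qT // => /andP[].
Qed.

(** So l_q is constant on (k, m], which absorbs the shift in [reach_cycV_lt]. If u_q(i) < l_q(i),
    stretchedness applies. Otherwise let M = l_q(i) >= m and y = M + 1. If u_q(i) < y, neither
    R_{i,M,y} nor its inverse is in A, against (c). If not, the inverse of R_{i,M,y} is in A, and so
    is R_{i,m,y}, being below R_{k,m,y}; then (b) gives T_{i,y}, against the choice of M. *)
Lemma reachV_plateau i x : k < i -> i <= m -> reach q^-1 m x -> reach q^-1 i x.
Proof.
move=> ki; rewrite leq_eqVlt => /orP[/eqP/val_inj->//|im] Lmx; apply: contraT => nLix.
case: (admA) => _ _ bA cA; have [Uim Lim] := qm ki (ltnW im).
have [|/existsPn H] := boolP [exists y : 'I_n, ~~ reach q i y && reach q^-1 i y].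
  case/existsP => y /andP[nUiy Liy].
  by rewrite (good_L goodq Uim nUiy Liy Lmx) in nLix.
have LU y : reach q^-1 i y -> reach q i y.
  by move=> Ly; have := H y; rewrite Ly andbT negbK.
have [M [iM LiM nLiM]] := reach_max q^-1 i.
have Mx : M < x by rewrite ltnNge; apply: contra nLix => xM; apply: reach_le LiM _ _.
have mM : m <= M by rewrite leqNgt; apply: contra nLiM => Mm; apply: reach_le Lim _ _.
have [y yE] := ord_succ Mx; rewrite -yE in nLiM Mx.
have {}iM : i < M by apply: leq_trans mM.
have My : M < y by rewrite yE.
have iy := ltn_trans iM My; have my := leq_ltn_trans mM My.
have kM := ltn_trans ki iM; have kmm := ltn_trans ki im.
have Lmy : reach q^-1 m y by apply: reach_le Lmx _ _.
have LMy : reach q^-1 M y by apply: reach_le Lmy _ _.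
have UMy : reach q M y by rewrite yE -reach_succV -yE.
have UiM := LU M LiM.
have [Uiy|nUiy] := boolP (reach q i y); last first.
  have := cA i M y iM My; rewrite -!qT // UiM LiM UMy LMy => /(_ isT isT).
  by rewrite -qR // -qV // (negPf nUiy) (negPf nLiM) !andbF; case.
have V : (cycle3 i M y)^-1 \in A by rewrite -qV // LiM LMy.
have Umy : reach q m y by apply: reach_le Uiy _ _; rewrite // ltnW.
have R : cycle3 i m y \in A.
  apply: (adm_R_nested admA my (orA kmm my _ _)); rewrite ?mP // -?qT ?Umy //.
  exact: ltnW.
have T : tperm i y \in A by apply: (bA i m M y).
by move: T; rewrite -qT // (negPf nLiM) andbF.
Qed.

Lemma reach_step i (z : nat) : k < i -> reach p i z = reach q i z.
Proof.
move=> ki; rewrite (reach_cyc km fq _ (ltnW ki)); apply/orP/idP => [[zm|//]|]; last by right.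
have [im|/ltnW mi] := leqP i m; last by apply: reach_diag => //; apply: leq_trans mi.
by have [Uim _] := qm ki im; apply: reach_le Uim _ _.
Qed.

Lemma reachV_step i x : k < i -> reach p^-1 i x = reach q^-1 i x.
Proof.
move=> ki; have [mi|im] := leqP m i; first by rewrite (reach_cycV_ge q km _ mi).
rewrite (reach_cycV_lt km fq _ (ltnW ki) im); apply/idP/idP => [L|L]; last exact: reach_le L _ _.
by apply: (reachV_plateau ki (ltnW im)); apply: reach_le L _ _.
Qed.

Lemma reach_step_k (z : nat) : reach p k z = (z <= m).
Proof.
rewrite (reach_cyc km fq _ (leqnn k)) (@reach_fixed _ k.+1) // orb_idr // => zk.
exact: leq_trans zk km.
Qed.

Lemma reachV_step_k x : reach p^-1 k x = reach q^-1 m x.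
Proof.
move: (km); rewrite leq_eqVlt => /orP[/eqP/val_inj E|km'].
  by rewrite (reach_cycV_ge q km) -E.
rewrite (reach_cycV_lt km fq _ (leqnn k) km'); apply/idP/idP => L; first by apply: reach_le L _ _.
have k1n : k.+1 < n by apply: leq_ltn_trans km' (ltn_ord m).
exact: (@reachV_plateau (Ordinal k1n)).
Qed.

Lemma step_fixes : fixes_below k p.
Proof. exact: cyc_fixes. Qed.

Lemma step_below : below p = A.
Proof.
case: (admA) => sA _ bA cA.
have lowT i j : i < j -> i < k -> tperm i j \notin A.
  by move=> ij ik; apply/negP => /(adm_tperm_ge fixA ij); rewrite leqNgt ik.
have low i j : i < j -> i < k -> reach p i j = false.
  by move=> ij ik; rewrite (reach_fixed _ step_fixes) // leqNgt ij.
apply: eq_below => // [i j ij|i j l ij jl|i j l ij jl].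
- rewrite mem_belowT //; have [ik|ki|/val_inj ik] := ltngtP i k.
  + by rewrite low // (negPf (lowT _ _ ij ik)).
  + by rewrite reach_step // reachV_step // qT.
  + subst i; rewrite reach_step_k reachV_step_k mP //; apply: andb_idr => jm.
    by apply: reach_diag.
- rewrite mem_belowR //; have [ik|ki|/val_inj ik] := ltngtP i k.
  + rewrite low //; apply/esym/negP => /(adm_RT admA ij jl)[T _].
    by rewrite (negPf (lowT _ _ ij ik)) in T.
  + have kj := ltn_trans ki ij.
    by rewrite !reach_step // reachV_step // qR.
  + subst i; rewrite reach_step_k reachV_step_k reach_step //.
    apply/and3P/idP => [[jm Ujl Lml]|R].
      apply: orA => //; first by rewrite mP.
      by rewrite -qT // Ujl reachV_plateau.
    have [] := adm_RT admA ij jl R; rewrite mP // -qT // => jm /andP[Ujl Ljl].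
    by split=> //; apply: reach_le Ljl _ _.
- rewrite mem_belowV //; have [ik|ki|/val_inj ik] := ltngtP i k.
  + rewrite (low i l (ltn_trans ij jl) ik) !andbF.
    by apply/esym/negP => /(adm_VT admA ij jl)[T _]; rewrite (negPf (lowT _ _ ij ik)) in T.
  + have kj := ltn_trans ki ij.
    by rewrite reach_step // !reachV_step // qV.
  + subst i; rewrite reach_step_k reachV_step_k reachV_step //.
    have kl := ltn_trans ij jl.
    apply/and3P/idP => [[_ _ lm]|V]; first by case: (adm_TR admA ij jl); rewrite ?mP.
    have [Tkj Tjl] := adm_VT admA ij jl V.
    (* Orientation puts R_{k,j,l} in A; with its inverse, (b) forces T_{k,l} into A. *)
    have lm : l <= m.
      by rewrite -mP //; apply: (bA k j j l) => //; apply: orA.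
    have jm := leq_trans (ltnW jl) lm.
    split=> //; first exact: reach_diag.
    by move: Tjl; rewrite -qT // => /andP[].
Qed.

(** Above k this is inherited from [q]. At k nothing is to be checked, since u_p(k) = m <= l_q(m) =
    l_p(k). *)
Lemma step_U : stretched n (reach p^-1) (reach p).
Proof.
move=> i m' x y; have [ik|ki|/val_inj ik] := ltngtP i k.
- have fp := step_fixes; have fV := fixes_belowV fp => _.
  rewrite (reach_fixed y fp ik (ltn_ord i)) (reach_fixed y fV ik (ltn_ord i)).
  by move=> /negP.
- have [m'i|im'] := leqP m' i; first by move=> _ _ _ H; apply: reach_le H _ _.
  have km' := ltn_trans ki im'; rewrite !reach_step // !reachV_step //.
  exact: (good_U goodq).
- subst i; rewrite !reach_step_k !reachV_step_k => _ /negP nL ym; case: nL.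
  exact: reach_diag.
Qed.

(** At k the middle index is at most u_p(k) = m, and l_p(k) = l_q(m) dominates l_p up to m. *)
Lemma step_L : stretched n (reach p) (reach p^-1).
Proof.
move=> i m' x y; have [ik|ki|/val_inj ik] := ltngtP i k.
- have fp := step_fixes; have fV := fixes_belowV fp => _.
  rewrite (reach_fixed y fp ik (ltn_ord i)) (reach_fixed y fV ik (ltn_ord i)).
  by move=> /negP.
- have [m'i|im'] := leqP m' i; first by move=> _ _ _ H; apply: reach_le H _ _.
  have km' := ltn_trans ki im'; rewrite !reach_step // !reachV_step //.
  exact: (good_L goodq).
- subst i; rewrite !reach_step_k !reachV_step_k => m'm _ _ H.
  have [m'k|km'] := leqP m' k.
    by rewrite -reachV_step_k; apply: reach_le H _ _.
  by move: H; rewrite reachV_step // => H; apply: reach_le H _ _.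
Qed.

(** The bounds make [t] fix all i < k and give t k <= m. So [t] splits off [cyc k (t k)], the other
    factor satisfies the bounds for [q], and [bruhat_cyc] recombines them. *)
Lemma step_max t : (forall i x, reach t i x -> reach p i x) ->
  (forall i x, reach t^-1 i x -> reach p^-1 i x) -> bruhat t p.
Proof.
move=> HU HL; have ft : fixes_below k t.
  apply: fixes_of_reach => i z ik /HU.
  by rewrite (reach_fixed _ step_fixes).
have [kx ft' tE] := cyc_split ft; set t' := permcomp _ t in ft' tE.
have xm : t k <= m by rewrite -reach_step_k; apply: HU; apply: (@reachI _ _ _ _ k).
rewrite tE; apply: bruhat_cyc => //; apply: (good_max goodq) => i z.
  have [ik|ki] := leqP i k.
    by rewrite !(@reach_fixed _ k.+1).
  by rewrite -reach_step // => H; apply: HU; rewrite tE (reach_cyc kx ft' _ (ltnW ki)) H orbT.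
have [ik|ki] := leqP i k.
  by rewrite !(@reach_fixed _ k.+1) //; apply: fixes_belowV.
move=> H; rewrite -reachV_step //; apply: HL; rewrite tE.
have [xi|ix] := leqP (t k) i; first by rewrite (reach_cycV_ge t' kx).
by rewrite (reach_cycV_lt kx ft' _ (ltnW ki) ix); apply: reach_le H _ _.
Qed.

Lemma step_prod prec w : compatible A prec -> perm_eq w (enum (part_T A)) ->
  sorted prec w -> permcomp_prod w = p.
Proof.
move=> co wD sw; rewrite (sorted_prod_cyc admA co fixA orA km mP wD sw).
congr permcomp; apply: (good_prod goodq (compatible_stabilized co)); last first.
  case: (co) => -[_ tr _] _; apply: (sorted_filter_in tr) sw.
  by apply/allP => s; rewrite (perm_mem wD) mem_enum.
apply: uniq_perm; [|exact: enum_uniq|move=> s].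
  by rewrite filter_uniq // (perm_uniq wD) enum_uniq.
 rewrite mem_filter (perm_mem wD) !mem_enum !inE.
by rewrite andbA (andbC (s k == k)).
Qed.

Lemma good_step : good k A p.
Proof.
split; [exact: step_fixes|exact: step_below|exact: step_U|exact: step_L|exact: step_max| |].
  by have [prec co] := good_order goodq; exists (extend_order prec); apply: extend_compatible.
exact: step_prod.
Qed.

End Step.

(** * Existence for every admissible set, and uniqueness of the greatest element *)

Section Existence.

Variable n : nat.
Implicit Types (s t p : 'S_n) (x y z i j k l m : 'I_n) (A : {set 'S_n}) (v w : seq 'S_n).

Lemma fixes_all s (b : nat) : n <= b -> fixes_below b s -> s = 1.
Proof.
by move=> nb fs; apply/permP => x; rewrite perm1 fs // (leq_trans (ltn_ord x)).
Qed.

Lemma bruhat_refl s : bruhat s s.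
Proof. exact/bruhatP. Qed.

(** The rank functions agree; once the values before x agree, the rank at (x, y) tells whether s x
    <= y. *)
Lemma bruhat_anti s t : bruhat s t -> bruhat t s -> s = t.
Proof.
move=> /bruhatP st /bruhatP ts; apply/permP => x.
have [c] := ubnP (x : nat); elim: c x => // c IH x xc.
have E p y : rank p x y = ((p x <= y) + #|[set z : 'I_n | (z < x) && (p z <= y)]|)%N.
  rewrite /rank (cardsD1 x) inE leqnn; congr (_ + _)%N; apply: eq_card => z.
  by rewrite !inE ltn_neqAle -val_eqE andbA.
have H y : (s x <= y) = (t x <= y).
  have : rank s x y = rank t x y by apply/eqP; rewrite eqn_leq st ts.
  rewrite !E; have -> : [set z : 'I_n | (z < x) && (s z <= y)] =
                        [set z : 'I_n | (z < x) && (t z <= y)].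
    apply/setP => z; rewrite !inE; apply: andb_id2l => zx.
    by rewrite IH // (leq_trans zx).
  by move/addIn; case: (_ <= _); case: (_ <= _).
by apply: val_inj; apply/eqP; rewrite eqn_leq H leqnn -H leqnn.
Qed.

Lemma good_base (b : nat) A : n <= b -> admissible A ->
  (forall s, s \in A -> fixes_below b s) -> good b A 1.
Proof.
move=> nb [sA _ _ _] fA.
have r1 (i j : 'I_n) : reach (1 : 'S_n) i j = (j <= i).
  by rewrite (@reach_fixed _ b) ?(leq_trans _ nb) // => x _; rewrite perm1.
have A1 s : s \in A -> s = 1 by move/fA/(fixes_all nb).
have T0 i j : i < j -> (tperm i j \in A) = false.
  move=> ij; apply/negP => /A1 E; have := tpermL i j; rewrite E perm1 => e.
  by rewrite e ltnn in ij.
have below1 : below (1 : 'S_n) = A.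
  apply: eq_below => // [i j ij|i j k ij jk|i j k ij jk].
  - by rewrite T0 // mem_belowT // r1 leqNgt ij.
  - rewrite mem_belowR // (r1 i j) [_ <= i]leqNgt ij /=; apply/esym/negP => /A1 E.
    by have [+ _ _ _] := cycle3E ij jk; rewrite E perm1 => e; rewrite e ltnn in ij.
  - rewrite mem_belowV // invg1 (r1 i j) [_ <= i]leqNgt ij /=; apply/esym/negP => /A1 E.
    have [+ _ _ _] := cycle3VE ij jk; have := ltn_trans ij jk.
    by rewrite E perm1 => + e; rewrite e ltnn.
have D0 : part_T A = set0.
  apply/setP => s; rewrite in_set0 in_setI; apply/negP => /andP[sA' /transpositionsP[i [j [ij E]]]].
  by rewrite E T0 in sA'.
split=> //.
- by move=> x _; rewrite perm1.
- by move=> i m x y; rewrite invg1 !r1 => _ /negP.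
- by move=> i m x y; rewrite invg1 !r1 => _ /negP.
- move=> t H _; suff -> : t = 1 by apply: bruhat_refl.
  by apply: (fixes_all (leqnn n)); apply: fixes_of_reach => i z _ /H; rewrite r1.
- exists (fun _ _ => false); split; last by move=> i j k ij _; rewrite T0.
  by rewrite D0; split=> [s|s t p|s t]; rewrite inE.
- move=> prec w _ wD _; suff -> : w = [::] by rewrite permcomp_prod_nil.
  by apply: size0nil; rewrite (perm_size wD) -cardE D0 cards0.
Qed.

Lemma good_exists (b : nat) A : admissible A -> (forall s, s \in A -> fixes_below b s) ->
  exists p, good b A p.
Proof.
have [c] := ubnP (n - b); elim: c b A => // c IH b A bc admA fA.
have [nb|bn] := leqP n b; first by exists 1; apply: good_base.
pose k := Ordinal bn.
have main B : admissible B -> (forall s, s \in B -> fixes_below k s) -> R_oriented B k ->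
    exists p, good b B p.
  move=> admB fB oB; have [m [km mP]] := top_exists k admB.
  have [q gq] : exists q, good b.+1 (stabilized B k) q.
    apply: IH (stabilized_admissible admB fB) _; first by lia.
    by move=> s; apply: (stabilized_fixes fB).
  by exists (permcomp (cyc k m) q); apply: (good_step admB fB oB gq km mP).
have [|oV] := adm_oriented k admA; first exact: main.
have [|p gp] := main _ (admissibleV admA) _ oV.
  by move=> s; rewrite mem_invg => /fA/fixes_belowV; rewrite invgK.
by exists p^-1; apply: goodV => //; rewrite invgK.
Qed.

Lemma adm_pi_eq A p : is_adm_pi A p -> adm_pi A = p.
Proof.
move=> Hp; rewrite /adm_pi; case: pickP => [r Hr|/(_ p)]; last by rewrite Hp.
have [/andP[Ep mp] /andP[Er mr]] := (Hp, Hr).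
apply: bruhat_anti; first by have /implyP := forallP mp r; apply.
by have /implyP := forallP mr p; apply.
Qed.

End Existence.

(** * Smooth permutations *)

Section Smooth.

Variable n : nat.
Implicit Types (s t p : 'S_n) (x y z i j k l m : 'I_n) (v w : seq 'S_n).

Lemma mem_below_T s i j : i < j ->
  (tperm i j \in below_T s) = reach s i j && reach s^-1 i j.
Proof. by move=> ij; rewrite [LHS]in_set mem_transpositions //= bruhat_tperm. Qed.

Lemma below_TP s t : t \in below_T s ->
  exists i j, [/\ i < j, t = tperm i j, reach s i j & reach s^-1 i j].
Proof.
move=> tB; have : t \in transpositions n by move: tB; rewrite [in X in X -> _]in_set => /andP[].
case/transpositionsP => i [j [ij E]]; exists i, j.
by move: tB; rewrite E mem_below_T // => /andP[].
Qed.

Lemma below_TV s : below_T s^-1 = below_T s.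
Proof.
have sub p : below_T p^-1 \subset below_T p.
  apply/subsetP => t /below_TP[i [j [ij -> r]]]; rewrite invgK => r'.
  by rewrite mem_below_T // r r'.
by apply/eqP; rewrite eqEsubset sub -{1}[s]invgK sub.
Qed.

Lemma perm_length_leV s : perm_length s <= perm_length s^-1.
Proof.
pose f (u : 'I_n * 'I_n) := (s u.2, s u.1).
have inj : injective f by move=> [a b] [c d] [] /perm_inj-> /perm_inj->.
rewrite /perm_length -(card_imset _ inj); apply/subset_leq_card/subsetP.
by move=> _ /imsetP[[a b] + ->]; rewrite !inE /= !permK andbC.
Qed.

(** Unlike in [cyc_succ], the new factor stands on the right and is T_{k,m}; this yields the
    factorization T_{k,k+1} ... T_{k,m}. *)
Lemma cyc_succ_r k l m : k <= l -> m = l.+1 :> nat ->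
  cyc k m = permcomp (cyc k l) (tperm k m).
Proof.
move=> kl ml; have km : k <= m by rewrite ml leqW.
apply/permP => x; apply: val_inj; rewrite /= permcompE !cycE //.
by case: tpermP => [->|->|/eqP + /eqP]; rewrite -?val_eqE /=; do ?case: ifP; lia.
Qed.

Lemma cyc_prod k m : k <= m -> exists v,
  [/\ permcomp_prod v = cyc k m, uniq v, size v = m - k
    & forall t, t \in v -> exists j, [/\ k < j, j <= m & t = tperm k j]].
Proof.
have [c] := ubnP (m : nat); elim: c m => // c IH m mc.
rewrite leq_eqVlt => /orP[/eqP/val_inj<-|km].
  by exists [::]; rewrite permcomp_prod_nil cyc_id subnn.
have l_n : m.-1 < n by apply: leq_ltn_trans (ltn_ord m); exact: leq_pred.
have [|| v [Ev uv sv Hv]] := IH (Ordinal l_n) => /=; try lia.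
exists (rcons v (tperm k m)); split.
- rewrite permcomp_prod_rcons Ev (@cyc_succ_r k (Ordinal l_n) m) //=; lia.
- rewrite rcons_uniq uv andbT; apply/negP => /Hv[j [kj jm /eqP]].
  by rewrite tperm_eq // -!val_eqE /= in jm *; lia.
- by rewrite size_rcons sv /=; lia.
- move=> t; rewrite mem_rcons inE => /orP[/eqP->|/Hv[j [kj jm ->]]]; first by exists m.
  by exists j; split=> //=; move: jm => /=; lia.
Qed.

(** The inequality is carried along because the induction step deduces equality for the smaller
    permutation from equality for the larger one. *)
Definition smooth_prod s := perm_length s <= #|below_T s| /\
  (perm_length s = #|below_T s| ->
   exists w, perm_eq w (enum (below_T s)) /\ s = permcomp_prod w).

Lemma smooth_prodV s : smooth_prod s^-1 -> smooth_prod s.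
Proof.
have E : perm_length s^-1 = perm_length s.
  by apply/eqP; rewrite eqn_leq perm_length_leV -{2}[s]invgK perm_length_leV.
rewrite /smooth_prod below_TV E => -[le H]; split=> // /H[w [wB sE]].
exists (rev w); split; first by rewrite perm_rev.
rewrite permcomp_prod_rev -?sE ?invgK // => t; rewrite (perm_mem wB) mem_enum.
by case/below_TP => i [j [_ -> _ _]]; rewrite tpermV.
Qed.

(** * Splitting the cycle off a permutation *)

Section Step.

Variables (k m : 'I_n) (t : 'S_n).
Hypotheses (km : k <= m) (ft : fixes_below k.+1 t).
Let s := permcomp (cyc k m) t.
Hypothesis ms : m <= s^-1 k.

(** The inversions at position k are indexed by the m - k values in [k, m). Any other inversion of
    [s] is one of [t], as the cycle is increasing on values above k. *)
Lemma perm_length_step : perm_length s <= perm_length t + (m - k).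
Proof.
pose I := [set y : 'I_n | k <= y < m].
have cI : #|I| = m - k.
  rewrite -sum1_card big_mkcond /= -{1}(sum_interval km (ltnW (ltn_ord m))) addKn.
  by apply: eq_bigr => x _; rewrite inE; case: ifP.
rewrite -cI -(card_imset I (f := fun y => (k, s^-1 y))); last by move=> x y [] /perm_inj.
apply: leq_trans (leq_card_setU _ _); apply/subset_leq_card/subsetP => -[x y].
rewrite !inE /= => /andP[xy syx].
have fs : fixes_below k s by apply: cyc_fixes.
have kx : k <= x.
  rewrite leqNgt; apply/negP => xk; move: syx; rewrite (fs x xk).
  have sy : s y <= x -> False.
    move=> sy; have /perm_inj E := fs (s y) (leq_ltn_trans sy xk).
    by rewrite E leqNgt xy in sy.
  by move/ltnW.
have [xk|xk] := eqVneq x k.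
  apply/orP; right; apply/imsetP; exists (s y); last by rewrite permK xk.
  rewrite inE; move: syx; rewrite xk (cyc_at km ft) => ->; rewrite andbT.
  rewrite leqNgt; apply/negP => syk; have /perm_inj E := fs (s y) syk.
  by rewrite E -xk ltnNge (ltnW xy) in syk.
apply/orP; left; rewrite xy /=; have {}kx : k < x by rewrite ltn_neqAle kx andbT eq_sym.
have tk z : k < z -> k < t z.
  move=> kz; rewrite ltnNge; apply/negP => H.
  by have /perm_inj E := ft (H : t z < k.+1); rewrite E leqNgt kz in H.
move: syx; rewrite !permcompE !cycE //; have := tk _ kx; have := tk _ (ltn_trans kx xy).
by do ?case: ifP; lia.
Qed.

Lemma below_T_step r : r \in below_T t -> r \in below_T s /\ r k = k.
Proof.
case/below_TP => i [j [ij -> U L]].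
have ki : k < i.
  by rewrite ltnNge; apply/negP => ik; move: U; rewrite (@reach_fixed _ k.+1) // leqNgt ij.
split; last by rewrite tpermD // -val_eqE /= gtn_eqF // (ltn_trans ki).
rewrite mem_below_T // (reach_cyc km ft _ (ltnW ki)) U orbT /=.
have [mi|im] := leqP m i; first by rewrite (reach_cycV_ge t km).
by rewrite (reach_cycV_lt km ft _ (ltnW ki) im); apply: reach_le L _ _.
Qed.

Lemma below_T_step_k j : k < j -> j <= m -> tperm k j \in below_T s.
Proof.
move=> kj jm; rewrite mem_below_T // (@reachI _ _ _ _ k) ?(cyc_at km ft) //=.
by apply: (@reachI _ _ _ _ k) => //; apply: leq_trans jm ms.
Qed.

(** The factors of the cycle and the transpositions below [t] are distinct elements below [s]. If
    the length of [s] equals the number of transpositions below [s], counting forces equality for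
    [t] and leaves no other transposition below [s]. *)
Lemma smooth_prod_step : smooth_prod t -> smooth_prod s.
Proof.
case=> le_t eq_t; have [v [Ev uv sv Hv]] := cyc_prod km.
have sub w : perm_eq w (enum (below_T t)) ->
    [/\ uniq (v ++ w), {subset v ++ w <= enum (below_T s)}
      & size (v ++ w) = (#|below_T t| + (m - k))%N].
  move=> wB; split; last by rewrite size_cat sv (perm_size wB) -cardE addnC.
    rewrite cat_uniq uv (perm_uniq wB) enum_uniq andbT /=; apply/hasPn => r.
    rewrite (perm_mem wB) mem_enum => /below_T_step[_ rk]; apply/negP => /Hv[j [kj _ E]].
    by have := tpermL k j; rewrite -E rk => e; rewrite e ltnn in kj.
  move=> r; rewrite mem_cat mem_enum => /orP[/Hv[j [kj jm ->]]|].
    exact: below_T_step_k.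
  by rewrite (perm_mem wB) mem_enum => /below_T_step[].
have le_s := perm_length_step.
have [u0 s0 z0] := sub _ (perm_refl _).
have le_B := uniq_leq_size u0 s0; rewrite z0 -cardE in le_B.
split; first by apply: leq_trans le_s _; apply: leq_trans le_B; rewrite leq_add2r.
move=> eq_s; have [|w [wB tE]] := eq_t.
  by apply/eqP; rewrite eqn_leq le_t -(leq_add2r (m - k)) (leq_trans le_B) // -eq_s.
exists (v ++ w); have [u1 s1 z1] := sub w wB; split.
  have [|_ E] := uniq_min_size u1 s1.
    by rewrite z1 -cardE -eq_s (leq_trans le_s) // leq_add2r.
  by apply: uniq_perm => //; apply: enum_uniq.
by rewrite permcomp_prod_cat Ev -tE.
Qed.

End Step.

Lemma smooth_prod_all s : smooth_prod s.
Proof.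
suff H (b : nat) : forall s, fixes_below b s -> smooth_prod s by apply: (H 0).
have [c] := ubnP (n - b); elim: c b => // c IH b bc {}s fs.
have [nb|bn] := leqP n b.
  rewrite (fixes_all nb fs); have E : perm_length (1 : 'S_n) = 0.
    by apply: eq_card0 => -[x y]; rewrite !inE !perm1 /=; case: ltngtP.
  split; rewrite E // => /esym B0; exists [::]; rewrite permcomp_prod_nil; split=> //.
  by rewrite (cards0_eq B0) enum_set0.
have main p : fixes_below b p -> p (Ordinal bn) <= p^-1 (Ordinal bn) -> smooth_prod p.
  move=> fp le; have [km ft pE] := @cyc_split _ (Ordinal bn) p fp.
  rewrite pE; apply: smooth_prod_step => //; first by rewrite -pE.
  by apply: (IH b.+1) => //; lia.
(* The assumption of [main] on the values at the index b holds for [s] or for [s^-1]. *)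
have [le|/ltnW le] := leqP (s (Ordinal bn)) (s^-1 (Ordinal bn)); first exact: main.
by apply: smooth_prodV; apply: main; rewrite ?invgK //; apply: fixes_belowV.
Qed.

End Smooth.

Theorem theorem1p2 (n : nat) (n_gt0 : (0 < n)%N) :
  (forall A : {set 'S_n}, admissible A ->
     [/\ is_adm_pi A (adm_pi A),
         exists prec : rel 'S_n, compatible A prec
       & forall (prec : rel 'S_n) (w : seq 'S_n),
           compatible A prec ->
           perm_eq w (enum (part_T A)) -> sorted prec w ->
           adm_pi A = permcomp_prod w]) /\
  (forall s : 'S_n, smooth s ->
     exists w : seq 'S_n,
       perm_eq w (enum (below_T s)) /\ s = permcomp_prod w).
Proof.
split=> [A admA|s /eqP Hs]; last by case: (smooth_prod_all s) => _; apply.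
(* For b = 0 no index is required to be fixed. *)
have [//|p gp] := @good_exists n 0 A admA.
have Hp := good_is_adm_pi gp; rewrite (adm_pi_eq Hp); split=> //; first by case: gp.
by move=> prec w co wD sw; rewrite (good_prod gp co wD sw).
Qed.
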